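(* Let $\{\mathcal S,\mathcal A,\mathcal P,r,\gamma,\rho\}$ be a discounted MDP with rewards in $[-R,R]$, $R>0$, $\gamma\in(0,1)$, horizon $H\ge 1$, let $\{\pi_\theta\}_{\theta\in\mathbb R^d}$ be a parameterized policy class, and let $\Theta\subseteq\mathbb R^d$ be a nonempty closed convex set such that $J$ attains its maximum over $\Theta$. Suppose: (A1) there are constants $G,M>0$ with $\|\nabla_\theta\log\pi_\theta(a|s)\|_2\le G$ and $\|\nabla_\theta^2\log\pi_\theta(a|s)\|_2\le M$ for all $\theta\in\mathbb R^d$, $a\in\mathcal A$, $s\in\mathcal S$; (A2) there is a constant $\xi>0$ with $\mathrm{Var}(g(\tau|\theta))\le\xi^2$ for all policies $\pi_\theta$, where $\tau\sim p(\cdot|\theta)$; (A3) there is a constant $W<\infty$ such that $\mathrm{Var}_{\tau\sim p(\cdot|\theta_2)}\big(p(\tau|\theta_1)/p(\tau|\theta_2)\big)\le W$ for all $\theta_1,\theta_2\in\mathbb R^d$. Let $L=MR/(1-\gamma)^2+2G^2R/(1-\gamma)^3$, $\eta=1/(4L)$ and $\theta_0\in\Theta$. Then there is a constant $C>0$, independent of $\epsilon$, such that for every $\epsilon\in(0,1]$ there are positive integers $N\le C/\epsilon$, $B\le C/\epsilon^{1/2}$, $m\le C/\epsilon^{1/2}$, $S\le C/\epsilon^{1/2}$ with $$B\ \ge\ \frac{72\,m\,\eta\, G^2\,(2G^2/M+1)(W+1)\gamma}{(1-\gamma)^2}$$ for which the algorithm SRVR-PG (defined in the context), run from $\theta_0$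 with parameters $S,m,\eta,N,B$, outputs a point $\theta_{\rm out}$ satisfying $\mathbb E[\|\mathcal G_\eta(\theta_{\rm out})\|_2^2]\le\epsilon$ while sampling at most $C/\epsilon^{3/2}$ trajectories in total.
   Context: Trajectories. A trajectory is $\tau=(s_0,a_0,s_1,a_1,\dots,s_{H-1},a_{H-1},s_H)$. Under policy $\pi_\theta$ its distribution is $p(\tau|\theta)=\rho(s_0)\prod_{h=0}^{H-1}\pi_\theta(a_h|s_h)\mathcal P(s_{h+1}|s_h,a_h)$, where $\rho$ is the initial-state distribution and $\mathcal P$ the transition kernel. The reward is $r:\mathcal S\times\mathcal A\to[-R,R]$, and the performance function is $J(\theta)=\mathbb E_{\tau\sim p(\cdot|\theta)}\big[\sum_{h=0}^{H-1}\gamma^h r(s_h,a_h)\big]$. Gradient estimator (PGT/GPOMDP, zero baseline): $$g(\tau|\theta)=\sum_{h=0}^{H-1}\Big(\sum_{t=0}^{h}\nabla_\theta\log\pi_\theta(a_t|s_t)\Big)\gamma^h r(s_h,a_h)=\sum_{h=0}^{H-1}\nabla_\theta\log\pi_\theta(a_h|s_h)\sum_{t=h}^{H-1}\gamma^t r(s_t,a_t).$$ For a random vector $X$, $\mathrm{Var}(X)=\mathbb E\|X-\mathbb EX\|_2^2$. For matrices $\|\cdot\|_2$ is the spectral norm. Step-wise importance-weighted estimator: for a trajectory $\tau$ sampled from the behavior parameter $\theta_1$, and target parameter $\theta_2$, $$g_\omega(\tau|\theta_2)=\sum_{h=0}^{H-1}\omega_{0:h}(\tau|\theta_2,\theta_1)\Big(\sum_{t=0}^{h}\nabla_{\theta_2}\log\pi_{\theta_2}(a_t|s_t)\Big)\gamma^h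 r(s_h,a_h),\qquad \omega_{0:h}(\tau|\theta_2,\theta_1)=\prod_{h'=0}^{h}\frac{\pi_{\theta_2}(a_{h'}|s_{h'})}{\pi_{\theta_1}(a_{h'}|s_{h'})}.$$ Projection and gradient mapping. $\mathcal P_\Theta(\theta)=\operatorname{argmin}_{u\in\Theta}\|\theta-u\|_2^2$ and $\mathcal G_\eta(\theta)=\frac1\eta\big(\mathcal P_\Theta(\theta+\eta\nabla J(\theta))-\theta\big)$. Algorithm SRVR-PG. Set $\tilde\theta^0=\theta_0\in\Theta$. For $s=0,\dots,S-1$: (i) set $\theta_0^{s+1}=\tilde\theta^s$; sample $N$ independent trajectories $\tau_1,\dots,\tau_N$ from $p(\cdot|\tilde\theta^s)$; set $v_0^{s+1}=\frac1N\sum_{i=1}^N g(\tau_i|\tilde\theta^s)$ and $\theta_1^{s+1}=\mathcal P_\Theta(\theta_0^{s+1}+\eta v_0^{s+1})$; (ii) for $t=1,\dots,m-1$: sample $B$ fresh independent trajectories $\tau_1,\dots,\tau_B$ from $p(\cdot|\theta_t^{s+1})$; set $v_t^{s+1}=v_{t-1}^{s+1}+\frac1B\sum_{j=1}^B\big(g(\tau_j|\theta_t^{s+1})-g_\omega(\tau_j|\theta_{t-1}^{s+1})\big)$, where $g_\omega(\cdot|\theta_{t-1}^{s+1})$ uses behavior parameter $\theta_t^{s+1}$ and target parameter $\theta_{t-1}^{s+1}$; set $\theta_{t+1}^{s+1}=\mathcal P_\Theta(\theta_t^{s+1}+\eta v_t^{s+1})$; (iii) set $\tilde\theta^{s+1}=\theta_m^{s+1}$.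 The output $\theta_{\rm out}$ is drawn uniformly at random from $\{\theta_t^{s}:0\le t\le m-1,\ 1\le s\le S\}$, independently of everything else. The total number of trajectories sampled is $S(N+(m-1)B)$. The constant $C$ may depend on the MDP, the policy class, $\Theta$, $\theta_0$, $G,M,R,\gamma,\xi,W$, but not on $\epsilon$. *)

(* Defs.v *)
From HB Require Import structures.
From mathcomp Require Import all_boot all_order all_algebra.
From mathcomp Require Import all_classical all_reals all_analysis.
From mathcomp Require Import measurable_realfun.

Set Implicit Arguments.
Unset Strict Implicit.
Unset Printing Implicit Defensive.

Import Order.TTheory GRing.Theory Num.Theory.
Import numFieldNormedType.Exports.

Local Open Scope classical_set_scope.
Local Open Scope ring_scope.

Section euclidean.
Context {R : realType} {d : nat}.
Implicit Types (v : 'rV[R]_d) (M : 'M[R]_d) (f : 'rV[R]_d -> R).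

(* The library norm on ['rV_d] is the sup norm. *)
Definition l2norm v : R := Num.sqrt (\sum_(i < d) v ord0 i ^+ 2).

(* Vectors are rows, so [M] acts on the right; the spectral norm is invariant
   under transposition. *)
Definition spectral_norm M : R :=
  sup [set l2norm (v *m M) | v in [set v | l2norm v <= 1]].

Definition grad f (x : 'rV[R]_d) : 'rV[R]_d :=
  \row_i 'D_(delta_mx ord0 i) f x.

Definition hessian f (x : 'rV[R]_d) : 'M[R]_d := jacobian (grad f) x.

Definition twice_differentiable f :=
  (forall x, differentiable f x) /\ (forall x, differentiable (grad f) x).

(* The default value [x] is irrelevant when [D] is nonempty, closed and
   convex. *)
Definition proj (D : set 'rV[R]_d) (x : 'rV[R]_d) : 'rV[R]_d :=
  xget x [set u | D u /\
    forall w, D w -> l2norm (x - u) ^+ 2 <= l2norm (x - w) ^+ 2].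

End euclidean.

Section vector_variance.
Context d (T : measurableType d) {R : realType} (P : probability T R) (n : nat).

Definition vmean (X : T -> 'rV[R]_n) : 'rV[R]_n :=
  \row_i fine 'E_P[fun t => X t ord0 i].

Definition vvar (X : T -> 'rV[R]_n) : \bar R :=
  'E_P[fun t => l2norm (X t - vmean X) ^+ 2].

End vector_variance.

Section kernel_composition.
Local Open Scope ereal_scope.
Context d1 d2 d3 (X : measurableType d1) (Y : measurableType d2)
  (Z : measurableType d3) {R : realType}
  (k1 : R.-pker X ~> Y) (k2 : R.-pker (X * Y)%type ~> Z).

Definition pkcomp : X -> {measure set Z -> \bar R} := mkcomp k1 k2.

Let pkcomp_measurable U : measurable U -> measurable_fun setT (pkcomp ^~ U).
Proof.
move=> mU; exact: (measurable_kernel [the R.-sfker X ~> Z of mkcomp k1 k2] U mU).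
Qed.

HB.instance Definition _ :=
  isKernel.Build _ _ X Z R pkcomp pkcomp_measurable.

Let pkcomp_setT x : pkcomp x setT = 1.
Proof.
rewrite /pkcomp /mkcomp /= /kcomp.
under eq_integral do rewrite prob_kernel.
by rewrite integral_cst// mul1e prob_kernel.
Qed.

HB.instance Definition _ :=
  Kernel_isProbability.Build _ _ X Z R pkcomp pkcomp_setT.

End kernel_composition.

(* A kernel that ignores the first component of its argument. *)
Section kernel_snd.
Local Open Scope ereal_scope.
Context d1 d2 d3 (X : measurableType d1) (Y : measurableType d2)
  (Z : measurableType d3) {R : realType} (k : R.-pker Y ~> Z).

Definition pksnd (xy : X * Y) : {measure set Z -> \bar R} := k xy.2.

Let pksnd_measurable U : measurable U -> measurable_fun setT (pksnd ^~ U).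
Proof.
by move=> mU; exact: (measurableT_comp (measurable_kernel k U mU) measurable_snd).
Qed.

HB.instance Definition _ :=
  isKernel.Build _ _ (X * Y)%type Z R pksnd pksnd_measurable.

Let pksnd_setT xy : pksnd xy setT = 1.
Proof. exact: prob_kernel. Qed.

HB.instance Definition _ :=
  Kernel_isProbability.Build _ _ (X * Y)%type Z R pksnd pksnd_setT.

End kernel_snd.

(* Law of [n] independent draws from [P]. *)
Section iid.
Context d (T : measurableType d) {R : realType} (P : probability T R).

Definition tcons n (x : T * n.-tuple T) : n.+1.-tuple T := [tuple of x.1 :: x.2].

Lemma measurable_tcons n : measurable_fun setT (@tcons n).
Proof. exact: (measurable_cons measurable_fst measurable_snd). Qed.

HB.instance Definition _ n :=
  @isMeasurableFun.Build _ _ _ _ (@tcons n) (@measurable_tcons n).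

Fixpoint iid n : probability (n.-tuple T) R :=
  if n is n'.+1 then distribution (P \x iid n')%E (@tcons n')
  else dirac [tuple].

End iid.

Record mdp dS dA (S : measurableType dS) (A : measurableType dA)
    (R : realType) := MDP {
  trans : R.-pker (S * A)%type ~> S;
  init : probability S R;
  reward : S * A -> R;
  discount : R;
  horizon : nat;
  measurable_reward : measurable_fun setT reward }.

(* [pi th s a] is the density [pi_th(a|s)] with respect to the reference
   measure [nu] on actions (for instance the counting or the Lebesgue measure).
   It is positive because the log-likelihood is used at every action. *)
Record policy_class dS dA (S : measurableType dS) (A : measurableType dA)
    (R : realType) (nu : {sigma_finite_measure set A -> \bar R}) (d : nat) :=
  PolicyClass {
  pi :> 'rV[R]_d -> S -> A -> R;
  pi_gt0 : forall th s a, 0 < pi th s a;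
  measurable_pi : forall th,
    measurable_fun setT (fun sa : S * A => pi th sa.1 sa.2);
  pi_mass : forall th s, (\int[nu]_a (pi th s a)%:E = 1)%E }.

Section policy_kernel.
Local Open Scope ereal_scope.
Context dS dA (S : measurableType dS) (A : measurableType dA) {R : realType}
  (nu : {sigma_finite_measure set A -> \bar R}) (d : nat)
  (pol : policy_class S nu d) (th : 'rV[R]_d).

Definition policy_set (s : S) (U : set A) : \bar R :=
  \int[nu]_(a in U) (pol th s a)%:E.

Let policy_section s : measurable_fun setT (fun a => (pol th s a)%:E).
Proof.
apply/measurable_EFinP.
exact: (measurableT_comp (measurable_pi pol th) (measurable_pair1 s)).
Qed.

Let policy_set0 s : policy_set s set0 = 0.
Proof. exact: integral_set0. Qed.

Let policy_set_ge0 s U : 0 <= policy_set s U.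
Proof. by apply: integral_ge0 => a _; rewrite lee_fin ltW// pi_gt0. Qed.

Let policy_set_sigma_additive s : semi_sigma_additive (policy_set s).
Proof.
move=> F mF tF mUF; rewrite /policy_set ge0_integral_bigcup//.
- apply: is_cvg_ereal_nneg_natsum_cond => n _ _.
  by apply: integral_ge0 => a _; rewrite lee_fin ltW// pi_gt0.
- exact: measurable_funTS.
- by move=> a _; rewrite lee_fin ltW// pi_gt0.
Qed.

HB.instance Definition _ s := isMeasure.Build _ _ _ (policy_set s)
  (policy_set0 s) (policy_set_ge0 s) (@policy_set_sigma_additive s).

Definition policy_kernel : S -> {measure set A -> \bar R} := policy_set.

Let policy_kernel_measurable U :
  measurable U -> measurable_fun setT (policy_kernel ^~ U).
Proof.
move=> mU; rewrite /policy_kernel /= /policy_set.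
under eq_fun do rewrite integral_mkcond.
pose f (sa : S * A) : \bar R := ((fun a => (pol th sa.1 a)%:E) \_ U) sa.2.
apply: (measurable_fun_fubini_tonelli_F (m2 := nu) f).
  rewrite /f [X in measurable_fun _ X](_ : _ =
    (fun sa : S * A => (pol th sa.1 sa.2)%:E * (\1_U sa.2)%:E)); last first.
    apply/funext => -[s a] /=; rewrite patchE indicE.
    by case: (a \in U); rewrite ?mule1 ?mule0.
  apply: emeasurable_funM; first by apply/measurable_EFinP; exact: measurable_pi.
  apply/measurable_EFinP; apply: measurableT_comp => //.
by move=> [s a]; rewrite /f patchE; case: ifP => // _; rewrite lee_fin ltW// pi_gt0.
Qed.

HB.instance Definition _ :=
  isKernel.Build _ _ S A R policy_kernel policy_kernel_measurable.

Let policy_kernel_setT s : policy_kernel s setT = 1.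
Proof. exact: pi_mass. Qed.

HB.instance Definition _ :=
  Kernel_isProbability.Build _ _ S A R policy_kernel policy_kernel_setT.

End policy_kernel.

(* A trajectory [((s_0,a_0), ..., (s_{n-1},a_{n-1})), s_n]. *)
Notation traj S A n := (n.-tuple (S * A) * S)%type.

Section trajectory_law.
Context dS dA (S : measurableType dS) (A : measurableType dA) {R : realType}
  (nu : {sigma_finite_measure set A -> \bar R}) (d : nat)
  (D : mdp S A R) (pol : policy_class S nu d) (th : 'rV[R]_d).

Definition traj_nil (s : S) : traj S A 0 := ([tuple], s).

Definition traj_cons n (x : (S * A * S) * traj S A n) : traj S A n.+1 :=
  ([tuple of x.1.1 :: x.2.1], x.2.2).

Lemma measurable_traj_nil : measurable_fun setT traj_nil.
Proof. exact: (measurable_fun_pair (measurable_cst _) (@measurable_id _ _ _)). Qed.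

Lemma measurable_traj_cons n : measurable_fun setT (@traj_cons n).
Proof.
apply: measurable_fun_pair.
  apply: measurable_cons.
    exact: measurableT_comp measurable_fst measurable_fst.
  exact: measurableT_comp measurable_fst measurable_snd.
exact: measurableT_comp measurable_snd measurable_snd.
Qed.

(* From [s]: draw [a ~ pi_th(.|s)], then [s' ~ P(.|s,a)], then the remaining
   [n-1] steps from [s']. *)
Fixpoint rollout n : R.-pker S ~> traj S A n :=
  if n is n'.+1 then
    pkcomp (policy_kernel pol th)
      (pkcomp (trans D)
        (pkcomp (pksnd (rollout n'))
          (kdirac (@measurable_traj_cons n'))))
  else kdirac measurable_traj_nil.

Definition traj_law (U : set (traj S A (horizon D))) : \bar R :=
  (\int[init D]_s rollout (horizon D) s U)%E.

Let traj_law0 : traj_law set0 = 0%E.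
Proof.
by rewrite /traj_law; under eq_integral do rewrite measure0; rewrite integral0.
Qed.

Let traj_law_ge0 U : (0 <= traj_law U)%E.
Proof. exact: integral_ge0. Qed.

Let traj_law_sigma_additive : semi_sigma_additive traj_law.
Proof.
move=> F mF tF mUF; rewrite [X in _ --> X](_ : _ =
    \int[init D]_s (\sum_(n <oo) rollout (horizon D) s (F n)))%E; last first.
  apply: eq_integral => s _.
  by apply/esym/cvg_lim => //; exact: measure_semi_sigma_additive.
rewrite integral_nneseries//; last by move=> n; exact: measurable_kernel.
apply: is_cvg_ereal_nneg_natsum_cond => n _ _; exact: integral_ge0.
Qed.

HB.instance Definition _ := isMeasure.Build _ _ _ traj_law
  traj_law0 traj_law_ge0 traj_law_sigma_additive.

Let traj_law_setT : traj_law setT = 1%E.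
Proof.
rewrite /traj_law; under eq_integral do rewrite prob_kernel.
by rewrite integral_cst// mul1e; exact: probability_setT.
Qed.

HB.instance Definition _ :=
  Measure_isProbability.Build _ _ _ traj_law traj_law_setT.

End trajectory_law.
Arguments traj_law {dS dA S A R nu d} D pol th U.

Section policy_gradient.
Context dS dA (S : measurableType dS) (A : measurableType dA) {R : realType}
  (nu : {sigma_finite_measure set A -> \bar R}) (d : nat)
  (D : mdp S A R) (pol : policy_class S nu d).
Local Notation H := (horizon D).
Local Notation r := (reward D).
Local Notation gamma := (discount D).
Implicit Types (th : 'rV[R]_d) (tau : traj S A H).

Definition log_pi (sa : S * A) th : R := ln (pol th sa.1 sa.2).

Definition step tau (h : 'I_H) : S * A := tnth tau.1 h.

Definition performance th : R :=
  fine 'E_(traj_law D pol th)[fun tau =>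
    \sum_(h < H) gamma ^+ h * r (step tau h)].

Definition pg_estimator th tau : 'rV[R]_d :=
  \sum_(h < H) (gamma ^+ h * r (step tau h)) *:
    \sum_(t < H | (t <= h)%N) grad (log_pi (step tau t)) th.

(* [th2] is the target parameter, [th1] the behavior parameter. *)
Definition weight th2 th1 tau (h : 'I_H) : R :=
  \prod_(k < H | (k <= h)%N)
    (pol th2 (step tau k).1 (step tau k).2 / pol th1 (step tau k).1 (step tau k).2).

Definition is_pg_estimator th2 th1 tau : 'rV[R]_d :=
  \sum_(h < H) (weight th2 th1 tau h * gamma ^+ h * r (step tau h)) *:
    \sum_(t < H | (t <= h)%N) grad (log_pi (step tau t)) th2.

(* Density of [traj_law D pol th] with respect to the measure
   [init(ds_0) \prod_h nu(da_h) trans(ds_{h+1}|s_h,a_h)], which does not depend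
   on [th]; the factors rho and P of p(tau|th) are part of that measure and
   cancel in ratios. *)
Definition likelihood th tau : R :=
  \prod_(h < H) pol th (step tau h).1 (step tau h).2.

Definition gradient_mapping (Theta : set 'rV[R]_d) (eta : R) th : 'rV[R]_d :=
  eta^-1 *: (proj Theta (th + eta *: grad performance th) - th).

End policy_gradient.

(* A random element of [T] is represented by its expectation operator on
   nonnegative functions; a sampling step is integration against the sampling
   law, and adaptive sampling (the law depends on earlier draws) is iterated
   integration. Continuity of [pol] in the parameter and its measurability in
   (s,a) make it jointly measurable, so all integrands met in [srvr_pg] are
   measurable. *)
Section random_programs.
Local Open Scope ereal_scope.
Context {R : realType}.

Definition rand (T : Type) : Type := (T -> \bar R) -> \bar R.

Definition ret T (x : T) : rand T := fun f => f x.

Definition bind T U (m : rand T) (k : T -> rand U) : rand U :=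
  fun f => m (fun x => k x f).

Definition sample d (T : measurableType d) (P : probability T R) : rand T :=
  fun f => \int[P]_x f x.

Definition uniform_choice T (l : seq T) : rand T :=
  fun f => ((size l)%:R^-1)%:E * \sum_(x <- l) f x.

Definition expect T (m : rand T) (f : T -> R) : \bar R :=
  m (fun x => (f x)%:E).

End random_programs.

Section srvr_pg.
Context dS dA (S : measurableType dS) (A : measurableType dA) {R : realType}
  (nu : {sigma_finite_measure set A -> \bar R}) (d : nat)
  (D : mdp S A R) (pol : policy_class S nu d) (Theta : set 'rV[R]_d).
Context (m : nat) (eta : R) (N B : nat).
Local Notation Rd := 'rV[R]_d.

Definition batch n (th : Rd) : rand (n.-tuple (traj S A (horizon D))) :=
  sample (iid (traj_law D pol th) n).
Arguments batch n th : clear implicits.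

(* [k] variance-reduced steps from theta_{t-1} = [thp], theta_t = [th], v_{t-1} = [v];
   returns theta_t, ..., theta_{t+k}. *)
Fixpoint inner_loop (k : nat) (thp th v : Rd) : rand (seq Rd) :=
  if k is k'.+1 then
    bind (batch B th) (fun taus =>
      let v' := v + B%:R^-1 *: \sum_(j < B)
        (pg_estimator pol th (tnth taus j) -
         is_pg_estimator pol thp th (tnth taus j)) in
      bind (inner_loop k' th (proj Theta (th + eta *: v')) v') (fun ths =>
        ret (th :: ths)))
  else ret [:: th].

(* Returns theta_0, ..., theta_m. *)
Definition epoch (th0 : Rd) : rand (seq Rd) :=
  bind (batch N th0) (fun taus =>
    let v0 := N%:R^-1 *: \sum_(i < N) pg_estimator pol th0 (tnth taus i) in
    bind (inner_loop m.-1 th0 (proj Theta (th0 + eta *: v0)) v0) (fun ths =>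
      ret (th0 :: ths))).

(* Collects the iterates theta_0, ..., theta_{m-1} of each of [k] epochs; the
   next epoch starts from theta_m. *)
Fixpoint epochs (k : nat) (th : Rd) : rand (seq Rd) :=
  if k is k'.+1 then
    bind (epoch th) (fun ths =>
      bind (epochs k' (last th ths)) (fun rest => ret (take m ths ++ rest)))
  else ret [::].

Definition srvr_pg (nepochs : nat) (th0 : Rd) : rand Rd :=
  bind (epochs nepochs th0) (@uniform_choice R Rd).

Definition num_trajectories (nepochs : nat) : nat :=
  (nepochs * (N + m.-1 * B))%N.

End srvr_pg.

(* Main.v *)
(* A policy with bounded scores and Hessians has likelihood ratios that are
   exponentials of Lipschitz functions of the parameter: over a fixed horizon
   they are bounded, which makes every expectation below finite. A pointwise
   expansion of the ratios, combined with a change of measure, gives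
   |J(th + v) - J(th) - <E g(tau|th), v>| <= L |v|^2 for small v, then for all v
   by doubling v; so E g is the gradient of J and J is smooth. By the same change
   of measure the importance-weighted estimator is unbiased, and (A3) gives
   E |g(tau|th) - g_w(tau|th')|^2 <= K |th - th'|^2 at all distances.
   The theorem follows by backward induction along the algorithm, with the
   potential
     12/eta (J* - J(th_t)) + 8 k (|v_(t-1) - grad J(th_(t-1))|^2
                                  + K/B |th_t - th_(t-1)|^2)
   when k inner steps remain: one step decreases its expectation by at least
   |G_eta(th_t)|^2. Since the bounds are explicit functions of the current
   state, the nested integrals are only ever compared with integrals of
   measurable functions. *)
Require Import Defs.
From mathcomp Require Import all_boot all_order all_algebra.
From mathcomp Require Import all_classical all_reals all_analysis.
From mathcomp Require Import measurable_realfun ring lra.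

Set Implicit Arguments.
Unset Strict Implicit.
Unset Printing Implicit Defensive.

Import Order.TTheory GRing.Theory Num.Theory.
Import numFieldNormedType.Exports.

Local Open Scope classical_set_scope.
Local Open Scope ring_scope.

(* [all_analysis] also exports a [proj] (of product spaces). *)
Local Notation proj := Defs.proj.

(** * Euclidean geometry and calculus along lines *)

(** Differentiating [performance] under the integral sign would call for domination arguments. They
    are avoided: one quadratic bound whose linear term is the mean of [pg_estimator] yields the
    gradient and the smoothness together. It is first obtained for small increments because the
    quadratic remainder of the exponential is controlled only for small exponents. (A3) bounds the
    variance of the likelihood ratio by [W] however close the two parameters are, whereas variance
    reduction needs a bound that vanishes quadratically with their distance. Hence Lipschitz
    log-likelihoods are used at distance at most 1, and [W] only beyond. The resulting constant
    [Cdiff] depends on the horizon and is not the coefficient of the prescribed lower bound on [B],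
    so [B] is chosen above both requirements. The numbers 12 and 8 in the potential come from
    [descent_arith]: with 4 L eta = 1, a projected step leaves a surplus |th_(t+1) - th_t|^2 /
    eta^2, which pays for the K/B terms as long as 8 m K/B <= 1/eta^2. This is why [B] and [m] have
    the same order. *)

Section dot_product.
Context {R : realType} {d : nat}.
Implicit Types (u v w : 'rV[R]_d) (a : R).

Definition dot u v : R := \sum_(i < d) u ord0 i * v ord0 i.

Lemma dotC u v : dot u v = dot v u.
Proof. by apply: eq_bigr => i _; rewrite mulrC. Qed.

Lemma dotDl u v w : dot (u + v) w = dot u w + dot v w.
Proof. by rewrite -big_split/=; apply: eq_bigr => i _; rewrite mxE mulrDl. Qed.

Lemma dotZl a u w : dot (a *: u) w = a * dot u w.
Proof. by rewrite mulr_sumr; apply: eq_bigr => i _; rewrite mxE mulrA. Qed.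

Lemma dotNl u w : dot (- u) w = - dot u w.
Proof. by rewrite -scaleN1r dotZl mulN1r. Qed.

Lemma dotDr u v w : dot w (u + v) = dot w u + dot w v.
Proof. by rewrite dotC dotDl !(dotC w). Qed.

Lemma dotZr a u w : dot w (a *: u) = a * dot w u.
Proof. by rewrite dotC dotZl dotC. Qed.

Lemma dotNr u w : dot w (- u) = - dot w u.
Proof. by rewrite dotC dotNl dotC. Qed.

Definition dotE := (dotDl, dotDr, dotNl, dotNr, dotZl, dotZr).

Lemma dot_suml (I : Type) (s : seq I) (P : pred I) (F : I -> 'rV[R]_d) w :
  dot (\sum_(i <- s | P i) F i) w = \sum_(i <- s | P i) dot (F i) w.
Proof.
elim/big_rec2: _ => [|i y x _ <-]; last by rewrite dotDl.
by rewrite -(scale0r (0 : 'rV[R]_d)) dotZl mul0r.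
Qed.

Lemma dotvv_ge0 u : 0 <= dot u u.
Proof. by apply: sumr_ge0 => i _; rewrite -expr2 sqr_ge0. Qed.

Lemma dotvv_eq0 u : dot u u = 0 -> u = 0.
Proof.
move=> /eqP; rewrite psumr_eq0 => [|i _]; last by rewrite -expr2 sqr_ge0.
move=> /allP u0; apply/rowP => i; rewrite mxE; apply/eqP.
by have := u0 i (mem_index_enum i); rewrite mulf_eq0 orbb.
Qed.

Lemma l2norm_ge0 u : 0 <= l2norm u.
Proof. exact: sqrtr_ge0. Qed.

Lemma l2norm_sq u : l2norm u ^+ 2 = dot u u.
Proof.
rewrite /l2norm sqr_sqrtr; last by apply: sumr_ge0 => i _; rewrite sqr_ge0.
by apply: eq_bigr => i _; rewrite expr2.
Qed.

Lemma l2norm_eq0 u : l2norm u = 0 -> u = 0.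
Proof. by move=> u0; apply: dotvv_eq0; rewrite -l2norm_sq u0 expr0n. Qed.

Lemma l2normZ a u : l2norm (a *: u) = `|a| * l2norm u.
Proof.
apply/eqP; rewrite -(@eqrXn2 _ 2)// ?mulr_ge0 ?l2norm_ge0//.
by rewrite exprMn !l2norm_sq !dotE real_normK ?num_real// expr2 mulrA.
Qed.

Lemma l2normN u : l2norm (- u) = l2norm u.
Proof. by rewrite -scaleN1r l2normZ normrN normr1 mul1r. Qed.

Lemma l2norm0 : l2norm (0 : 'rV[R]_d) = 0.
Proof. by rewrite -(scale0r (0 : 'rV[R]_d)) l2normZ normr0 mul0r. Qed.

Lemma cauchy_schwarz u v : `|dot u v| <= l2norm u * l2norm v.
Proof.
rewrite -(@ler_pXn2r _ 2) ?nnegrE ?mulr_ge0 ?l2norm_ge0//.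
rewrite real_normK ?num_real// exprMn !l2norm_sq.
have [v0|/eqP v0] := eqVneq (dot v v) 0.
  rewrite (dotvv_eq0 v0) -(scale0r (0 : 'rV[R]_d)) !dotZr !mul0r.
  by rewrite expr0n mulr0.
have vp : 0 < dot v v by rewrite lt0r dotvv_ge0 andbT; apply/eqP.
rewrite -subr_ge0 -(pmulr_lge0 _ vp).
have := dotvv_ge0 (dot v v *: u - dot u v *: v).
by rewrite !dotE (dotC v u) => h; apply: (le_trans h); nra.
Qed.

Lemma dot_le u v : dot u v <= l2norm u * l2norm v.
Proof. exact: le_trans (ler_norm _) (cauchy_schwarz u v). Qed.

Lemma l2normD u v : l2norm (u + v) <= l2norm u + l2norm v.
Proof.
rewrite -(@ler_pXn2r _ 2) ?nnegrE ?addr_ge0 ?l2norm_ge0//.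
rewrite sqrrD !l2norm_sq !dotE (dotC v u).
have := dot_le u v; lra.
Qed.

Lemma l2norm_sum (I : Type) (s : seq I) (P : pred I) (F : I -> 'rV[R]_d) :
  l2norm (\sum_(i <- s | P i) F i) <= \sum_(i <- s | P i) l2norm (F i).
Proof.
elim/big_rec2: _ => [|i y x _ h]; first by rewrite l2norm0.
exact: le_trans (l2normD _ _) (lerD (lexx _) h).
Qed.

Lemma l2normD_sq u v :
  l2norm (u + v) ^+ 2 <= 2 * l2norm u ^+ 2 + 2 * l2norm v ^+ 2.
Proof.
rewrite !l2norm_sq; have := dotvv_ge0 (u - v); rewrite !dotE (dotC v u); lra.
Qed.

Lemma dot_young a u v :
  2 * (a * dot u v) <= a ^+ 2 * l2norm u ^+ 2 + l2norm v ^+ 2.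
Proof.
have := dotvv_ge0 (a *: u - v); rewrite !l2norm_sq !dotE (dotC v u); lra.
Qed.

Lemma ler_coord_l2norm u i : `|u ord0 i| <= l2norm u.
Proof.
rewrite -(@ler_pXn2r _ 2) ?nnegrE ?l2norm_ge0// real_normK ?num_real//.
rewrite l2norm_sq /dot (bigD1 i)//= expr2 lerDl.
by apply: sumr_ge0 => j _; rewrite -expr2 sqr_ge0.
Qed.

Lemma dot_delta u i : dot u (delta_mx ord0 i) = u ord0 i.
Proof.
rewrite /dot (bigD1 i)//= mxE !eqxx mulr1 big1 ?addr0// => j /negbTE ji.
by rewrite mxE eqxx ji mulr0.
Qed.

Lemma l2norm_delta i : l2norm (delta_mx ord0 i : 'rV[R]_d) = 1.
Proof.
apply/eqP; rewrite -(@eqrXn2 _ 2)// ?l2norm_ge0// l2norm_sq dot_delta.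
by rewrite mxE !eqxx expr1n.
Qed.

Lemma l2norm_le_sum u : l2norm u <= \sum_i `|u ord0 i|.
Proof.
rewrite {1}(row_sum_delta u); apply: (le_trans (l2norm_sum _ _ _)).
by apply: ler_sum => i _; rewrite l2normZ l2norm_delta mulr1.
Qed.

(** [sup] carries information only for bounded sets; the sum of the absolute entries is a crude
    bound that suffices. *)
Lemma has_ub_spectral (M : 'M[R]_d) :
  has_ubound [set l2norm (v *m M) | v in [set v : 'rV[R]_d | l2norm v <= 1]].
Proof.
exists (\sum_i \sum_j `|M j i|) => _ [w /= w1 <-].
apply: (le_trans (l2norm_le_sum _)); apply: ler_sum => i _.
rewrite mxE; apply: (le_trans (ler_norm_sum _ _ _)); apply: ler_sum => j _.
rewrite normrM ler_piMl//; exact: le_trans (ler_coord_l2norm _ _) w1.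
Qed.

Lemma spectral_norm_ge0 (M : 'M[R]_d) : 0 <= spectral_norm M.
Proof.
apply: (ub_le_sup (has_ub_spectral M)); exists 0 => /=.
  by rewrite l2norm0.
by rewrite mul0mx l2norm0.
Qed.

Lemma spectral_normP (M : 'M[R]_d) v :
  l2norm (v *m M) <= spectral_norm M * l2norm v.
Proof.
have [->|v0] := eqVneq v 0; first by rewrite mul0mx l2norm0 mulr0.
have nv : 0 < l2norm v.
  by rewrite lt0r l2norm_ge0 andbT; apply: contra_neq v0 => /l2norm_eq0.
rewrite -ler_pdivrMr// mulrC -[X in X * _]gtr0_norm ?invr_gt0// -l2normZ.
rewrite scalemxAl; apply: (ub_le_sup (has_ub_spectral M)).
exists ((l2norm v)^-1 *: v) => //=.
by rewrite l2normZ gtr0_norm ?invr_gt0// mulVf ?gt_eqF.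
Qed.

Lemma cvg_sumr (T : Type) (F : set_system T) (I : Type)
    (s : seq I) (f : I -> T -> R) (l : I -> R) : Filter F ->
  (forall i, f i x @[x --> F] --> l i) ->
  \sum_(i <- s) f i x @[x --> F] --> \sum_(i <- s) l i.
Proof. by move=> FF fl; apply: cvg_big => //; exact: add_continuous. Qed.

Lemma dot_continuous w : continuous (dot^~ w).
Proof.
move=> x; rewrite /dot.
apply: (@cvg_sumr _ (nbhs x) _ _ (fun i u => u ord0 i * w ord0 i)) => i.
by apply: cvgM; [exact: coord_continuous|exact: cvg_cst].
Qed.

Lemma l2norm_sq_continuous w : continuous (fun v => l2norm (w - v) ^+ 2).
Proof.
move=> x; rewrite (_ : (fun _ => _) =
    fun v => \sum_i (w ord0 i - v ord0 i) ^+ 2); last first.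
  by apply/funext => v; rewrite l2norm_sq; apply: eq_bigr => i _; rewrite !mxE.
apply: (@cvg_sumr _ (nbhs x) _ _ (fun i v => (w ord0 i - v ord0 i) ^+ 2)) => i.
rewrite expr2; under eq_fun do rewrite expr2.
by apply: cvgM; apply: cvgB; [exact: cvg_cst|exact: coord_continuous
  |exact: cvg_cst|exact: coord_continuous].
Qed.

End dot_product.

Section projection.
Context {R : realType} {d : nat} (D : set 'rV[R]_d).
Implicit Types x y w : 'rV[R]_d.
Hypotheses (D0 : D !=set0) (cD : closed D).

(** [proj] picks a minimizer through [xget], so one has to exist. The part [K] of [D] not farther
    from [x] than a chosen [w0] is compact and has a minimizer; a point of [D] outside [K] is worse
    than [w0]. *)
Lemma proj_spec x : D (proj D x) /\
  forall w, D w -> l2norm (x - proj D x) ^+ 2 <= l2norm (x - w) ^+ 2.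
Proof.
pose P := [set u | D u /\
  forall w, D w -> l2norm (x - u) ^+ 2 <= l2norm (x - w) ^+ 2].
apply: (xgetPex x (P := P)).
have [w0 Dw0] := D0.
pose K := D `&` [set u | l2norm (x - u) ^+ 2 <= l2norm (x - w0) ^+ 2].
have cK : compact K.
  apply: bounded_closed_compact.
    exists (l2norm x + l2norm (x - w0)); split => [|M hM u [_ /= hu]].
      exact: num_real.
    apply: le_trans (ltW hM).
    have {}hu : l2norm (x - u) <= l2norm (x - w0).
      by rewrite -(@ler_pXn2r _ 2) ?nnegrE ?l2norm_ge0.
    have hu' : l2norm u <= l2norm x + l2norm (x - w0).
      rewrite -[u in leLHS](subKr x) (le_trans (l2normD _ _))// l2normN.
      by rewrite lerD2l.
    rewrite [leLHS]/Num.norm/= mx_normrE; apply: bigmax_le => [|[i j] _ /=].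
      by rewrite addr_ge0 ?l2norm_ge0.
    by rewrite (ord1 i) (le_trans (ler_coord_l2norm _ _)).
  apply: closedI => //.
  apply: (@preimage_closed _ _ _ [set r | r <= l2norm (x - w0) ^+ 2]).
    by move=> u _; exact: l2norm_sq_continuous.
  exact: closed_le.
have K0 : K !=set0 by exists w0; split => /=.
have cf : {within K, continuous (fun v => l2norm (x - v) ^+ 2)}.
  by apply: continuous_subspaceT; exact: l2norm_sq_continuous.
have [u] := EVT_min_rV K0 cK cf.
rewrite inE => -[Du hu] umin; exists u; split => // w Dw.
have [h|h] := leP (l2norm (x - w) ^+ 2) (l2norm (x - w0) ^+ 2).
  by apply: umin; rewrite inE; split.
exact: le_trans hu (ltW h).
Qed.

Lemma proj_in x : D (proj D x).
Proof. by have [] := proj_spec x. Qed.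

Hypothesis convD : convex_set D.

Lemma proj_variational x w : D w -> dot (x - proj D x) (w - proj D x) <= 0.
Proof.
move=> Dw; set u := proj D x.
have [Du umin] := proj_spec x; rewrite -/u in Du umin.
have key (t : R) : 0 < t <= 1 -> 2 * dot (x - u) (w - u) <= t * dot (w - u) (w - u).
  move=> /andP[t0 t1].
  have Dt : D (u + t *: (w - u)).
    have -> : u + t *: (w - u) = t *: w + (1 - t) *: u.
      by rewrite scalerBr scalerBl scale1r addrCA.
    exact: set_mem (convD (Itv01 (ltW t0) t1) (mem_set Dw) (mem_set Du)).
  move: (umin _ Dt); rewrite !l2norm_sq !dotE => h.
  rewrite -(ler_pM2l t0); move: h; rewrite (dotC u x) (dotC w x) (dotC w u).
  by lra.
have b0 := dotvv_ge0 (w - u).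
rewrite leNgt; apply/negP => a0.
have ab0 : 0 < dot (x - u) (w - u) + dot (w - u) (w - u) by rewrite ltr_wpDr.
(* Writing a > 0 and b >= 0 for the two dot products of [key], the choice t = a / (a + b) gives 2 (a
   + b) <= b, a contradiction; this replaces the limit t -> 0. *)
have := key (dot (x - u) (w - u) / (dot (x - u) (w - u) + dot (w - u) (w - u))).
rewrite divr_gt0//= ler_pdivrMr// mul1r lerDl b0 => /(_ isT).
rewrite mulrAC ler_pdivlMr//; nra.
Qed.

(** Adding the variational inequalities of the two projections, each tested at the other, gives |u -
    v|^2 <= <x - y, u - v>. *)
Lemma proj_nonexpansive x y :
  l2norm (proj D x - proj D y) <= l2norm (x - y).
Proof.
have h1 := proj_variational x (proj_in y).
have h2 := proj_variational y (proj_in x).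
set u := proj D x in h1 h2 *; set v := proj D y in h1 h2 *.
have h3 : l2norm (u - v) ^+ 2 <= dot (x - y) (u - v).
  by rewrite l2norm_sq; move: h1 h2; rewrite !dotE; rewrite (dotC v u) ; lra.
have := le_trans h3 (dot_le _ _); rewrite expr2.
have [->|uv0] := eqVneq (l2norm (u - v)) 0; first by rewrite l2norm_ge0.
by rewrite ler_pM2r// lt0r uv0 l2norm_ge0.
Qed.

End projection.

Section line_calculus.
Context {R : realType} {d : nat}.
Implicit Types (f : 'rV[R]_d -> R) (x v w : 'rV[R]_d).

Lemma derive_dot_grad f x v :
  differentiable f x -> 'D_v f x = dot (grad f x) v.
Proof.
move=> df; rewrite deriveE// {1}(row_sum_delta v) linear_sum/=.
by apply: eq_bigr => i _; rewrite linearZ/= mxE deriveE// mulrC.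
Qed.

Lemma is_derive_line f x v (t : R) : derivable f (x + t *: v) v ->
  is_derive t 1 (fun s : R => f (x + s *: v)) ('D_v f (x + t *: v)).
Proof.
have E : (fun h : R => h^-1 *: (f (x + (h *: (1 : R) + t) *: v) - f (x + t *: v)))
    = (fun h => h^-1 *: (f (h *: v + (x + t *: v)) - f (x + t *: v))).
  by apply/funext => h; rewrite scalerDl /GRing.scale/= mulr1 addrCA.
move=> df; apply: DeriveDef; first by rewrite /derivable/= E.
by rewrite /derive/= E.
Qed.

Lemma mean_value_line f x v : (forall y, derivable f y v) ->
  exists2 c : R, 0 <= c <= 1 & f (x + v) - f x = 'D_v f (x + c *: v).
Proof.
move=> df.
have dl (t : R) : is_derive t 1 (fun s : R => f (x + s *: v)) ('D_v f (x + t *: v)).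
  by apply: is_derive_line.
have [|c] := MVT_segment (@ler01 R) (fun t _ => dl t).
  apply: continuous_subspaceT => t; apply: differentiable_continuous.
  by apply/derivable1_diffP; have [] := dl t.
rewrite in_itv/= => c01; rewrite scale0r addr0 scale1r subr0 mulr1 => E.
by exists c.
Qed.

Lemma grad_mean_value f x v : (forall y, differentiable f y) ->
  exists2 c : R, 0 <= c <= 1 & f (x + v) - f x = dot (grad f (x + c *: v)) v.
Proof.
move=> df; have [|c c01 E] := @mean_value_line f x v.
  by move=> y; exact: diff_derivable.
by exists c => //; rewrite E derive_dot_grad.
Qed.

Section bounded_derivatives.
Variables (f : 'rV[R]_d -> R) (G M : R).
Hypothesis f2 : twice_differentiable f.

Lemma lipschitz_grad : (forall x, l2norm (grad f x) <= G) ->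
  forall x v, `|f (x + v) - f x| <= G * l2norm v.
Proof.
move=> fG x v; have [c _ ->] := grad_mean_value x v f2.1.
apply: (le_trans (cauchy_schwarz _ _)).
by rewrite ler_wpM2r ?l2norm_ge0.
Qed.

Hypothesis fM : forall x, spectral_norm (hessian f x) <= M.

Lemma lipschitz_hessian x v : l2norm (grad f (x + v) - grad f x) <= M * l2norm v.
Proof.
set w := grad f (x + v) - grad f x.
pose h y := dot (grad f y) w.
have dh y : derivable h y v /\ 'D_v h y = dot (v *m hessian f y) w.
  rewrite -deriveEjacobian; last exact: f2.2.
  have dg : derivable (grad f) y v by apply: diff_derivable; exact: f2.2.
  have hc : t^-1 *: ((h \o shift y) (t *: v) - h y) @[t --> 0^'] -->
      dot ('D_v (grad f) y) w.
    rewrite (_ : (fun _ => _) = dot^~ w \o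
        (fun t => t^-1 *: ((grad f \o shift y) (t *: v) - grad f y))); last first.
      by apply/funext => t /=; rewrite dotZl dotDl dotNl.
    exact: (cvg_comp _ _ dg (@dot_continuous _ _ w _)).
  by split; [apply/cvg_ex; exists (dot ('D_v (grad f) y) w)|exact: cvg_lim].
have [y|c c01 E] := @mean_value_line h x v; first by have [] := dh y.
have {}E : l2norm w ^+ 2 = dot (v *m hessian f (x + c *: v)) w.
  by rewrite l2norm_sq {1}/w dotDl dotNl E; have [] := dh (x + c *: v).
have := dot_le (v *m hessian f (x + c *: v)) w; rewrite -E expr2.
have [->|w0] := eqVneq (l2norm w) 0.
  by rewrite mulr_ge0 ?l2norm_ge0// (le_trans _ (fM x))// spectral_norm_ge0.
rewrite ler_pM2r ?lt0r ?w0 ?l2norm_ge0// => /le_trans; apply.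
apply: (le_trans (spectral_normP _ _)).
by rewrite ler_wpM2r ?l2norm_ge0.
Qed.

(** The constant is [M] and not M/2: the mean value form has the gradient at an intermediate point,
    whose distance to [x] is simply bounded by |v|. The value of [Lsmooth] leaves room for this. *)
Lemma taylor_hessian x v :
  `|f (x + v) - f x - dot (grad f x) v| <= M * l2norm v ^+ 2.
Proof.
have [c /andP[c0 c1] ->] := grad_mean_value x v f2.1.
rewrite -dotNl -dotDl; apply: (le_trans (cauchy_schwarz _ _)).
rewrite expr2 mulrA ler_wpM2r ?l2norm_ge0//.
apply: (le_trans (lipschitz_hessian _ _)).
rewrite l2normZ ger0_norm// mulrCA ler_piMl//.
exact: le_trans (l2norm_ge0 _) (lipschitz_hessian x v).
Qed.

End bounded_derivatives.

End line_calculus.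

(** * Integration *)

Section integral_complements.
Local Open Scope ereal_scope.
Context d (T : measurableType d) (R : realType).
Implicit Types (mu : {measure set T -> \bar R}) (f g : T -> \bar R).

Import HBNNSimple.

(* No measurability is needed: the integral of a nonnegative function is a
   supremum over the simple functions below it. *)
Lemma ge0_le_integralW mu f g : (forall x, 0 <= f x) ->
  (forall x, f x <= g x) -> \int[mu]_x f x <= \int[mu]_x g x.
Proof.
move=> f0 fg; have g0 x : 0 <= g x := le_trans (f0 x) (fg x).
rewrite !ge0_integralTE//; apply: ereal_sup_le => _ [h /= hf <-].
by exists h => // x; exact: le_trans (hf x) (fg x).
Qed.

(** Both sides are monotone limits along the same simple functions approximating [f]; on a simple
    function they agree level set by level set, by the setwise density identity. *)
Lemma ge0_integral_density mu (kappa : {measure set T -> \bar R}) f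
    (g : T -> R) :
  (forall x, 0 <= f x) -> measurable_fun setT f ->
  (forall x, 0 <= g x)%R -> measurable_fun setT g ->
  (forall U, measurable U -> kappa U = \int[mu]_(x in U) (g x)%:E) ->
  \int[kappa]_x f x = \int[mu]_x (f x * (g x)%:E).
Proof.
move=> f0 mf g0 mg kE; pose f_ := nnsfun_approx measurableT mf.
have mf_ n : measurable_fun setT (EFin \o f_ n) by exact/measurable_EFinP.
have mge : measurable_fun setT (EFin \o g) by exact/measurable_EFinP.
transitivity (limn (fun n => \int[kappa]_x (f_ n x)%:E)).
  rewrite -monotone_convergence//.
  - apply: eq_integral => y _; apply/esym/cvg_lim => //.
    by apply: cvg_nnsfun_approx.
  - by move=> n y _; rewrite lee_fin.
  - by move=> y _ m n mn; rewrite lee_fin; exact/lefP/nd_nnsfun_approx.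
transitivity (limn (fun n => \int[mu]_x ((f_ n x)%:E * (g x)%:E))); last first.
  rewrite -monotone_convergence//; last 3 first.
  - by move=> n; exact: (emeasurable_funM (mf_ n) mge).
  - by move=> n x _; rewrite mule_ge0// lee_fin.
  - move=> y _ m n mn; apply: lee_wpmul2r; first by rewrite lee_fin.
    by rewrite lee_fin; exact/lefP/nd_nnsfun_approx.
  apply: eq_integral => y _; apply/cvg_lim => //.
  by apply: cvgeZr => //; apply: cvg_nnsfun_approx.
congr (limn _); apply/funext => n.
under eq_integral do rewrite fimfunE -fsumEFin//.
rewrite ge0_integral_fsum//; last 2 first.
- by move=> r; apply/measurable_EFinP/measurable_funM.
- by move=> r x _; rewrite EFinM nnfun_muleindic_ge0.
under [in RHS]eq_integral => x _.
  rewrite fimfunE -fsumEFin// ge0_mule_fsuml; last first.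
    by move=> r; rewrite EFinM nnfun_muleindic_ge0.
  over.
rewrite ge0_integral_fsum//; last 2 first.
- move=> r; apply: emeasurable_funM => //.
  by apply/measurable_EFinP/measurable_funM.
- by move=> r x _; rewrite mule_ge0 ?lee_fin//; exact: (nnfun_muleindic_ge0 (f_ n)).
apply: eq_fsbigr => r; rewrite inE => -[t _ <-].
rewrite integralZl_indic_nnsfun// integral_indic// setIT kE// integral_mkcond.
rewrite -ge0_integralZl//; last first.
- by rewrite lee_fin.
- by move=> x _; rewrite erestrict_ge0// => y _; rewrite lee_fin.
- by apply/(measurable_restrictT _ _).1 => //; exact: measurable_funTS.
apply: eq_integral => x _; rewrite patchE indicE EFinM -muleA; congr (_ * _).
by case: (x \in _); rewrite ?mul1e ?mul0e.
Qed.

Lemma ge0_integral_affine mu (phi : T -> R) (c a q : R) : mu setT = 1 ->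
  measurable_fun setT phi -> (forall x, 0 <= phi x)%R -> (0 <= c)%R ->
  (0 <= a)%R -> \int[mu]_x (phi x)%:E = q%:E ->
  \int[mu]_x (c + a * phi x)%:E = (c + a * q)%:E.
Proof.
move=> mu1 mphi phi0 c0 a0 phiq.
have mphie : measurable_fun setT (EFin \o phi) by exact/measurable_EFinP.
under eq_integral do rewrite EFinD EFinM.
rewrite (@ge0_integralD _ _ _ mu setT measurableT (cst c%:E)
  (fun x => a%:E * (phi x)%:E))//.
- rewrite integral_cst// [X in c%:E * X]mu1 mule1.
  rewrite ge0_integralZl//; first by rewrite phiq.
  by move=> x _; rewrite lee_fin.
- by move=> x _; rewrite mule_ge0// lee_fin.
- exact: measurable_funeM.
Qed.

End integral_complements.

Section bounded_measurable.
Context d (T : measurableType d) (R : realType) (P : probability T R).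
Implicit Types f g : T -> R.

(** Over a fixed horizon all quantities of one trajectory are bounded. Bounded measurable functions
    are stable under ring operations and integrable for every probability, so integrability never
    has to be tracked from one law to another. *)
Definition bmeas f := measurable_fun setT f /\ exists c, forall x, `|f x| <= c.

Lemma bmeas_cst c : bmeas (cst c).
Proof. by split; [exact: measurable_cst|exists `|c|]. Qed.

Lemma bmeasD f g : bmeas f -> bmeas g -> bmeas (fun x => f x + g x).
Proof.
move=> [mf [a fa]] [mg [b gb]]; split; first exact: measurable_funD.
by exists (a + b) => x; exact: le_trans (ler_normD _ _) (lerD (fa x) (gb x)).
Qed.

Lemma bmeasM f g : bmeas f -> bmeas g -> bmeas (fun x => f x * g x).
Proof.
move=> [mf [a fa]] [mg [b gb]]; split; first exact: measurable_funM.
by exists (a * b) => x; rewrite normrM ler_pM.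
Qed.

Lemma bmeasZ c f : bmeas f -> bmeas (fun x => c * f x).
Proof. exact: bmeasM (bmeas_cst c). Qed.

Lemma bmeasN f : bmeas f -> bmeas (fun x => - f x).
Proof.
move=> [mf [a fa]]; split; first exact: measurable_funN.
by exists a => x; rewrite normrN.
Qed.

Lemma bmeasB f g : bmeas f -> bmeas g -> bmeas (fun x => f x - g x).
Proof. by move=> bf bg; apply: bmeasD => //; exact: bmeasN. Qed.

Lemma bmeasX f n : bmeas f -> bmeas (fun x => f x ^+ n).
Proof.
move=> [mf [a fa]]; split; first exact: measurable_funX.
by exists (a ^+ n) => x; rewrite normrX lerXn2r ?nnegrE// (le_trans _ (fa x)).
Qed.

Lemma bmeas_sum I (s : seq I) (Q : pred I) (F : I -> T -> R) :
  (forall i, Q i -> bmeas (F i)) -> bmeas (fun x => \sum_(i <- s | Q i) F i x).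
Proof.
move=> bF; elim: s => [|i s IH].
  by under [X in bmeas X]eq_fun do rewrite big_nil; exact: bmeas_cst.
under [X in bmeas X]eq_fun do rewrite big_cons.
by case Qi: (Q i) => //; apply: bmeasD => //; exact: bF.
Qed.

Lemma bmeas_integrable f : bmeas f -> P.-integrable setT (EFin \o f).
Proof.
move=> [mf [c fc]]; apply: measurable_bounded_integrable => //.
  exact: le_lt_trans (probability_le1 P measurableT) (ltry _).
exists c; split; first exact: num_real.
by move=> M cM x _ /=; exact: le_trans (fc x) (ltW cM).
Qed.

Definition mean f : R := (\int[P]_x f x)%R.

Lemma EFin_mean f : bmeas f -> (\int[P]_x (f x)%:E = (mean f)%:E)%E.
Proof. by move=> bf; rewrite fineK// integrable_fin_num//; exact: bmeas_integrable. Qed.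

Lemma expectation_mean f : bmeas f -> ('E_P[f] = (mean f)%:E)%E.
Proof. by move=> bf; rewrite unlock; exact: EFin_mean. Qed.

Lemma mean_cst c : mean (cst c) = c.
Proof.
have h : (c%:E * P setT = c%:E)%E by rewrite (probability_setT P) mule1.
exact: (congr1 fine (etrans (integral_cst P measurableT c%:E) h)).
Qed.

Lemma meanD f g : bmeas f -> bmeas g ->
  mean (fun x => f x + g x) = mean f + mean g.
Proof. by move=> bf bg; apply: RintegralD => //; exact: bmeas_integrable. Qed.

Lemma meanZ c f : bmeas f -> mean (fun x => c * f x) = c * mean f.
Proof. by move=> bf; apply: RintegralZl => //; exact: bmeas_integrable. Qed.

Lemma meanN f : bmeas f -> mean (fun x => - f x) = - mean f.
Proof.
move=> bf; rewrite -mulN1r -meanZ//; congr mean.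
by apply/funext => x; rewrite mulN1r.
Qed.

Lemma meanB f g : bmeas f -> bmeas g ->
  mean (fun x => f x - g x) = mean f - mean g.
Proof. by move=> bf bg; rewrite meanD// ?meanN//; exact: bmeasN. Qed.

Lemma mean_sum I (s : seq I) (Q : pred I) (F : I -> T -> R) :
  (forall i, Q i -> bmeas (F i)) ->
  mean (fun x => \sum_(i <- s | Q i) F i x) = \sum_(i <- s | Q i) mean (F i).
Proof.
move=> bF; elim: s => [|i s IH].
  by rewrite big_nil -[RHS]mean_cst; congr mean; apply/funext => x; rewrite big_nil.
rewrite big_cons; under [X in mean X]eq_fun do rewrite big_cons.
case: ifPn => // Qi; rewrite meanD ?IH//; [exact: bF|exact: bmeas_sum].
Qed.

Lemma ler_mean f g : bmeas f -> bmeas g -> (forall x, f x <= g x) ->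
  mean f <= mean g.
Proof.
by move=> bf bg fg; apply: le_Rintegral => //; exact: bmeas_integrable.
Qed.

Lemma mean_ge0 f : (forall x, 0 <= f x) -> 0 <= mean f.
Proof. by move=> f0; exact: Rintegral_ge0. Qed.

Lemma ler_norm_mean f c : bmeas f -> (forall x, `|f x| <= c) -> `|mean f| <= c.
Proof.
move=> bf fc; rewrite ler_norml -{1}(mean_cst (- c)) -{2}(mean_cst c).
by rewrite !ler_mean//; try exact: bmeas_cst; move=> x; have := fc x;
  rewrite ler_norml => /andP[].
Qed.

End bounded_measurable.

Section iid_second_moment.
Context d (T : measurableType d) (R : realType) (P : probability T R) (n : nat).
Variable Y : T -> 'rV[R]_n.
Hypothesis bY : forall i, bmeas (fun x => Y x ord0 i).
Hypothesis Y0 : forall i, mean P (fun x => Y x ord0 i) = 0.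

Lemma bmeas_dot (Z1 Z2 : T -> 'rV[R]_n) :
  (forall i, bmeas (fun x => Z1 x ord0 i)) ->
  (forall i, bmeas (fun x => Z2 x ord0 i)) -> bmeas (fun x => dot (Z1 x) (Z2 x)).
Proof. by move=> b1 b2; apply: bmeas_sum => i _; exact: bmeasM. Qed.

Lemma measurable_sq_iid_sum k u : measurable_fun setT
  (fun xs : k.-tuple T => l2norm (u + \sum_(j < k) Y (tnth xs j)) ^+ 2).
Proof.
under eq_fun do rewrite l2norm_sq.
apply: measurable_sum => i.
have h : measurable_fun setT (fun xs : k.-tuple T =>
    (u + \sum_(j < k) Y (tnth xs j)) ord0 i).
  under eq_fun do rewrite mxE summxE.
  apply: measurable_funD => //; apply: measurable_sum => j.
  exact: (measurableT_comp (bY i).1 (measurable_tnth j)).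
exact: measurable_funM.
Qed.

(** The offset [u] is there for the induction: the first draw is absorbed into it, and the cross
    term 2 <u, Y> has mean zero. *)
Lemma iid_second_moment k u :
  (\int[iid P k]_xs (l2norm (u + \sum_(j < k) Y (tnth xs j)) ^+ 2)%:E =
   (l2norm u ^+ 2 + k%:R * mean P (fun x => l2norm (Y x) ^+ 2))%:E)%E.
Proof.
have mF k' w := (measurable_EFinP _ _).2 (@measurable_sq_iid_sum k' w).
have bYY : bmeas (fun x => l2norm (Y x) ^+ 2).
  by under [X in bmeas X]eq_fun do rewrite l2norm_sq; exact: bmeas_dot.
elim: k u => [|k IH] u.
  rewrite /= integral_dirac//; last exact: mF.
  by rewrite diracT mul1e big_ord0 addr0 mul0r addr0.
rewrite /= ge0_integral_distribution//=; last 2 first.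
- exact: mF.
- by move=> xs; rewrite lee_fin sqr_ge0.
rewrite (fubini_tonelli1 (fun x => (l2norm (u + \sum_(j < k.+1)
    Y (tnth (tcons x) j)) ^+ 2)%:E)); last 2 first.
- exact: (measurableT_comp (mF _ _) (@measurable_tcons _ T k)).
- by move=> x; rewrite lee_fin sqr_ge0.
rewrite /fubini_F.
have inner x : (\int[iid P k]_xs (l2norm (u + \sum_(j < k.+1)
    Y (tnth (tcons (x, xs)) j)) ^+ 2)%:E = (l2norm (u + Y x) ^+ 2 +
    k%:R * mean P (fun x => l2norm (Y x) ^+ 2))%:E)%E.
  rewrite -IH; apply: eq_integral => xs _; rewrite big_ord_recl addrA tnth0.
  by under eq_bigr do rewrite tnthS.
under eq_integral do rewrite inner.
have buY : bmeas (fun x => 2 * dot u (Y x)).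
  apply: bmeasZ; apply: bmeas_dot => // i; exact: bmeas_cst.
have E x : l2norm (u + Y x) ^+ 2 +
    k%:R * mean P (fun x => l2norm (Y x) ^+ 2) = l2norm (Y x) ^+ 2 +
    2 * dot u (Y x) +
    (l2norm u ^+ 2 + k%:R * mean P (fun x => l2norm (Y x) ^+ 2)).
  by rewrite !l2norm_sq !dotE (dotC (Y x) u); ring.
under eq_integral do rewrite E.
have b1 := bmeasD bYY buY; have b2 c := bmeasD b1 (bmeas_cst T c).
rewrite EFin_mean; last exact: b2.
congr EFin; rewrite meanD//; last exact: bmeas_cst.
rewrite mean_cst meanD// meanZ; last first.
  by apply: bmeas_dot => // i; exact: bmeas_cst.
rewrite /dot mean_sum => [|i _]; last by apply: bmeasZ.
under eq_bigr do rewrite meanZ// Y0 mulr0.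
by rewrite big1// -natr1; ring.
Qed.

End iid_second_moment.

(** * Change of measure between policies *)

Section rollout_integral.
Local Open Scope ereal_scope.
Context dS dA (S : measurableType dS) (A : measurableType dA) {R : realType}
  (nu : {sigma_finite_measure set A -> \bar R}) (d : nat)
  (D : mdp S A R) (pol : policy_class S nu d).
Implicit Types th : 'rV[R]_d.

Lemma policy_gt0 th s a : (0 < pol th s a)%R.
Proof. exact: Defs.pi_gt0. Qed.

Lemma measurable_pi_section th s : measurable_fun setT (pol th s).
Proof. exact: (measurableT_comp (measurable_pi pol th) (measurable_pair1 s)). Qed.

Lemma integral_policy th s (f : A -> \bar R) : (forall a, 0 <= f a) ->
  measurable_fun setT f ->
  \int[policy_kernel pol th s]_a f a = \int[nu]_a (f a * (pol th s a)%:E).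
Proof.
move=> f0 mf; apply: ge0_integral_density => //.
- by move=> a; rewrite ltW// policy_gt0.
- exact: measurable_pi_section.
Qed.

Lemma integral_pkcomp d1 d2 d3 (X : measurableType d1) (Y : measurableType d2)
    (Z : measurableType d3) (k1 : R.-pker X ~> Y)
    (k2 : R.-pker (X * Y)%type ~> Z) x (f : Z -> \bar R) :
  (forall z, 0 <= f z) -> measurable_fun setT f ->
  \int[pkcomp k1 k2 x]_z f z = \int[k1 x]_y \int[k2 (x, y)]_z f z.
Proof. by move=> f0 mf; exact: integral_kcomp. Qed.

(** The conditional expectation of [f] given the first state-action pair; it separates the density
    of the first action from all later randomness. *)
Definition rollout_tail th n (f : traj S A n.+1 -> \bar R) (sa : S * A) : \bar R :=
  \int[trans D sa]_s' \int[rollout D pol th n s']_tau f (traj_cons ((sa, s'), tau)).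

Lemma rollout_tailE th n (f : traj S A n.+1 -> \bar R) sa :
  (forall tau, 0 <= f tau) -> measurable_fun setT f ->
  \int[pkcomp (trans D) (pkcomp (pksnd (rollout D pol th n))
    (kdirac (@measurable_traj_cons _ _ S A n))) sa]_tau f tau =
  rollout_tail th f sa.
Proof.
move=> f0 mf; rewrite integral_pkcomp//; apply: eq_integral => s' _.
rewrite integral_pkcomp//; apply: eq_integral => tau _.
by rewrite integral_dirac// diracT mul1e.
Qed.

Lemma integral_rolloutS th n s (f : traj S A n.+1 -> \bar R) :
  (forall tau, 0 <= f tau) -> measurable_fun setT f ->
  \int[rollout D pol th n.+1 s]_tau f tau =
  \int[nu]_a (rollout_tail th f (s, a) * (pol th s a)%:E).
Proof.
move=> f0 mf; rewrite [LHS]integral_pkcomp// integral_policy; last 2 first.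
- by move=> a; apply: integral_ge0.
- pose k := pkcomp (trans D) (pkcomp (pksnd (rollout D pol th n))
    (kdirac (@measurable_traj_cons _ _ S A n))).
  apply: (measurable_fun_integral_kernel (l := fun a => k (s, a))) => //.
  move=> U mU.
  exact: (measurableT_comp (measurable_kernel k U mU) (measurable_pair1 s)).
by apply: eq_integral => a _; rewrite rollout_tailE.
Qed.

Lemma measurable_rollout_integral th n (f : traj S A n.+1 -> \bar R) sa :
  (forall tau, 0 <= f tau) -> measurable_fun setT f ->
  measurable_fun setT
    (fun s' => \int[rollout D pol th n s']_tau f (traj_cons ((sa, s'), tau))).
Proof.
move=> f0 mf; apply: (measurable_fun_integral_sfinite_kernel
  (fun z => f (traj_cons ((sa, z.1), z.2)))) => //.
apply: measurableT_comp => //.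
apply: (measurableT_comp (@measurable_traj_cons _ _ S A n)).
apply: measurable_fun_pair; last exact: measurable_snd.
by apply: measurable_fun_pair; [exact: measurable_cst|exact: measurable_fst].
Qed.

Definition ratio th' th (sa : S * A) : R := (pol th' sa.1 sa.2 / pol th sa.1 sa.2)%R.

Lemma ratio_gt0 th' th sa : (0 < ratio th' th sa)%R.
Proof. by rewrite divr_gt0// policy_gt0. Qed.

Lemma measurable_ratio th' th : measurable_fun setT (ratio th' th).
Proof.
have h : measurable_fun setT (fun sa : S * A =>
    expR (ln (pol th' sa.1 sa.2) - ln (pol th sa.1 sa.2))).
  apply: measurableT_comp => //; apply: measurable_funB.
    exact: (measurableT_comp (@measurable_ln R) (measurable_pi pol th')).
  exact: (measurableT_comp (@measurable_ln R) (measurable_pi pol th)).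
apply: eq_measurable_fun h => sa _.
by rewrite expRB !lnK// posrE policy_gt0.
Qed.

(** As [k] counts steps, [weight] at index [h] is the case [k = h.+1] and the likelihood ratio of
    (A3) is the case of the whole horizon. *)
Definition prefix_ratio th' th n k (tau : traj S A n) : R :=
  (\prod_(i < n | (i < k)%N) ratio th' th (tnth tau.1 i))%R.

Lemma measurable_tau_step n (i : 'I_n) :
  measurable_fun setT (fun tau : traj S A n => tnth tau.1 i).
Proof. exact: (measurableT_comp (measurable_tnth i) measurable_fst). Qed.

Lemma measurable_prefix_ratio th' th n k :
  measurable_fun setT (@prefix_ratio th' th n k).
Proof.
rewrite /prefix_ratio; under eq_fun do rewrite big_mkcond/=.
apply: (@measurable_prod _ _ _ _ _ _ (fun (i : 'I_n) (tau : traj S A n) =>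
  if (i < k)%N then ratio th' th (tnth tau.1 i) else 1%R)) => i _.
case: (i < k)%N; last exact: measurable_cst.
exact: (measurableT_comp (measurable_ratio _ _) (measurable_tau_step i)).
Qed.

Lemma prefix_ratio_ge0 th' th n k tau : (0 <= @prefix_ratio th' th n k tau)%R.
Proof. by apply: prodr_ge0 => i _; rewrite ltW// ratio_gt0. Qed.

(* [f] is a function of the first [k] state-action pairs. *)
Definition prefix_fun U n k (f : traj S A n -> U) := forall tau tau',
  (forall i : 'I_n, (i < k)%N -> tnth tau.1 i = tnth tau'.1 i) -> f tau = f tau'.

(** The first ratio turns the density [pol th] into [pol th'], the transition kernel does not
    involve the parameter, and the remaining rollout is an instance of the induction hypothesis with
    one step less in both [n] and [k]. *)
Lemma rollout_change_of_measure th' th n k s (f : traj S A n -> \bar R) :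
  (forall tau, 0 <= f tau) -> measurable_fun setT f -> prefix_fun k f ->
  \int[rollout D pol th n s]_tau ((prefix_ratio th' th k tau)%:E * f tau) =
  \int[rollout D pol th' n s]_tau f tau.
Proof.
elim: n k s f => [|n IH] k s f f0 mf pf.
  by apply: eq_integral => tau _; rewrite /prefix_ratio big_ord0 mul1e.
have mpf : measurable_fun setT (fun tau => (prefix_ratio th' th k tau)%:E * f tau).
  apply: emeasurable_funM => //; apply/measurable_EFinP.
  exact: measurable_prefix_ratio.
have pf0 tau : 0 <= (prefix_ratio th' th k tau)%:E * f tau.
  by rewrite mule_ge0// lee_fin prefix_ratio_ge0.
case: k => [|k] in pf mpf pf0 *.
  (* Past the prefix [f] is constant and every rollout has mass 1, so the remaining steps need no
     reweighting. *)
  have fE th1 : \int[rollout D pol th1 n.+1 s]_tau f tau = f point.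
    under eq_integral => tau _ do rewrite (pf tau point)//.
    by rewrite integral_cst// prob_kernel mule1.
  rewrite fE -(fE th); apply: eq_integral => tau _.
  by rewrite /prefix_ratio big1 ?mul1e.
rewrite !integral_rolloutS//; apply: eq_integral => a _.
have cons_meas s' : measurable_fun setT
    (fun tau => f (traj_cons (((s, a), s'), tau))).
  apply: measurableT_comp => //.
  by apply: (measurableT_comp (@measurable_traj_cons _ _ S A n)).
have -> : rollout_tail th (fun tau => (prefix_ratio th' th k.+1 tau)%:E * f tau)
    (s, a) = (ratio th' th (s, a))%:E * rollout_tail th' f (s, a).
  rewrite /rollout_tail -ge0_integralZl//; last first.
  - by rewrite lee_fin ltW// ratio_gt0.
  - by move=> s' _; exact: integral_ge0.
  - exact: measurable_rollout_integral.
  apply: eq_integral => s' _.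
  rewrite -(IH k)//; last first.
    move=> tau tau' h; apply: pf => i.
    by case: (unliftP ord0 i) => [j|] -> ij; rewrite ?tnthS ?tnth0// h.
  rewrite -ge0_integralZl//; last first.
  - by rewrite lee_fin ltW// ratio_gt0.
  - by move=> tau _; rewrite mule_ge0// lee_fin prefix_ratio_ge0.
  - apply: emeasurable_funM => //; apply/measurable_EFinP.
    exact: measurable_prefix_ratio.
  apply: eq_integral => tau _; rewrite muleA; congr (_ * _).
  rewrite -EFinM; congr EFin.
  rewrite /prefix_ratio big_mkcond big_ord_recl/= tnth0 -big_mkcond/=.
  by congr (_ * _)%R; apply: eq_bigr => i _; rewrite tnthS.
rewrite muleAC [RHS]muleC; congr (_ * _); rewrite -EFinM /ratio/=.
by rewrite divfK// gt_eqF// policy_gt0.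
Qed.

Lemma integral_traj_law th (f : traj S A (horizon D) -> \bar R) :
  (forall tau, 0 <= f tau) -> measurable_fun setT f ->
  \int[traj_law D pol th]_tau f tau =
  \int[init D]_s \int[rollout D pol th (horizon D) s]_tau f tau.
Proof.
move=> f0 mf.
(* The constant kernel on [unit] with value [init D] exhibits [traj_law] as a kernel composition. *)
pose l := kprobability (@measurable_cst _ _ unit (pprobability S R) setT (init D)).
rewrite -(@integral_kcomp _ _ _ _ _ _ _ l (pksnd (rollout D pol th (horizon D))) tt)//.
Qed.

Lemma change_of_measure th' th k (f : traj S A (horizon D) -> \bar R) :
  (forall tau, 0 <= f tau) -> measurable_fun setT f -> prefix_fun k f ->
  \int[traj_law D pol th]_tau ((prefix_ratio th' th k tau)%:E * f tau) =
  \int[traj_law D pol th']_tau f tau.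
Proof.
move=> f0 mf pf; have mpf : measurable_fun setT
    (fun tau => (prefix_ratio th' th k tau)%:E * f tau).
  apply: emeasurable_funM => //; apply/measurable_EFinP.
  exact: measurable_prefix_ratio.
have pf0 tau : 0 <= (prefix_ratio th' th k tau)%:E * f tau.
  by rewrite mule_ge0// lee_fin prefix_ratio_ge0.
apply: (etrans (integral_traj_law th pf0 mpf)).
apply: (etrans _ (esym (integral_traj_law th' f0 mf))).
by apply: eq_integral => s _; exact: rollout_change_of_measure.
Qed.

End rollout_integral.

(** * Smoothness of the performance function *)

Section real_bounds.
Context {R : realType}.
Implicit Types x g : R.

(** The upper bound squares exp(x/2) <= 1 / (1 - x/2). After clearing the denominator it needs 1 -
    3x + x^2 >= 0, which is where the threshold 1/3 comes from. *)
Lemma expR_taylor2 x : `|x| <= 3^-1 -> `|expR x - 1 - x| <= x ^+ 2.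
Proof.
rewrite ler_norml => /andP[xl xu].
have h1 := expR_ge1Dx x; rewrite ger0_norm; last by lra.
have h2 := expR_ge1Dx (- (x / 2)).
have p1 : 0 < 1 - x / 2 by lra.
have h3 : expR (x / 2) <= (1 - x / 2)^-1.
  rewrite -[leLHS]invrK lef_pV2 ?posrE ?invr_gt0 ?expR_gt0// -expRN.
  by move: h2; lra.
have -> : expR x = expR (x / 2) ^+ 2 by rewrite expr2 -expRD; congr expR; lra.
suff : expR (x / 2) ^+ 2 <= 1 + x + x ^+ 2 by lra.
apply: (@le_trans _ _ ((1 - x / 2)^-1 ^+ 2)).
  by rewrite lerXn2r ?nnegrE ?expR_ge0// invr_ge0 ltW.
rewrite exprVn -div1r ler_pdivrMr ?exprn_gt0//.
have -> : (1 + x + x ^+ 2) * (1 - x / 2) ^+ 2 =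
    1 + x ^+ 2 * (4^-1 * (1 - 3 * x + x ^+ 2)) by field.
by rewrite lerDl mulr_ge0 ?sqr_ge0// mulr_ge0//; have := sqr_ge0 x; lra.
Qed.

Lemma expR_sub1_le x a : `|x| <= a -> `|expR x - 1| <= expR a * `|x|.
Proof.
move=> xa; have h1 := expR_ge1Dx x; have h2 := expR_ge1Dx (- x).
have a0 : 1 <= expR a.
  by rewrite -expR0 ler_expR (le_trans _ xa).
have [x0|x0] := leP 0 x.
  have x1 : 1 <= expR x by rewrite -expR0 ler_expR.
  rewrite (ger0_norm x0) in xa *; rewrite ger0_norm; last by lra.
  have h3 : expR x - 1 <= expR x * x.
    have : expR x * expR (- x) = 1 by rewrite -expRD subrr expR0.
    by have := expR_gt0 x; nra.
  apply: (le_trans h3); rewrite ler_wpM2r// ler_expR//.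
have x1 : expR x <= 1 by rewrite -expR0 ler_expR ltW.
have e0 : expR x - 1 <= 0 by lra.
by rewrite (ltr0_norm x0) (ler0_norm e0); nra.
Qed.

(** The right-hand side is the sum of the infinite series. Splitting off the first term factors out
    [g] and shifts [c] to [c + 1], a recursion that the closed form satisfies exactly; the next
    lemma works in the same way. *)
Lemma sum_arith_geometric g n c : 0 < g < 1 -> 0 <= c ->
  \sum_(h < n) (h%:R + c) * g ^+ h <= c / (1 - g) + g / (1 - g) ^+ 2.
Proof.
move=> /andP[g0 g1]; have ap : 0 < 1 - g by lra.
elim: n c => [|n IH] c c0.
  by rewrite big_ord0 addr_ge0// divr_ge0 ?exprn_ge0// ltW.
rewrite big_ord_recl/= expr0 mulr1 add0r.
have -> : \sum_(i < n) ((bump 0 i)%:R + c) * g ^+ (bump 0 i) =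
    g * \sum_(i < n) (i%:R + (c + 1)) * g ^+ i.
  rewrite mulr_sumr; apply: eq_bigr => i _.
  by rewrite /bump leq0n add1n (exprS g) -natr1; ring.
apply: (@le_trans _ _ (c + g * ((c + 1) / (1 - g) + g / (1 - g) ^+ 2))).
  by rewrite lerD2l ler_wpM2l ?IH ?addr_ge0// ltW.
by rewrite le_eqVlt; apply/orP; left; apply/eqP; field; rewrite gt_eqF.
Qed.

Lemma sum_sqr_geometric g n c : 0 < g < 1 -> 0 <= c ->
  \sum_(h < n) (h%:R + c) ^+ 2 * g ^+ h <=
  c ^+ 2 / (1 - g) + 2 * c * g / (1 - g) ^+ 2 + g * (1 + g) / (1 - g) ^+ 3.
Proof.
move=> /andP[g0 g1]; have ap : 0 < 1 - g by lra.
elim: n c => [|n IH] c c0.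
  have i0 k : 0 <= ((1 - g) ^+ k)^-1 by rewrite invr_ge0 exprn_ge0 ?ltW.
  have := i0 1; rewrite expr1 => i1.
  rewrite big_ord0 !addr_ge0// mulr_ge0 ?sqr_ge0// ?mulr_ge0//; lra.
rewrite big_ord_recl/= expr0 mulr1 add0r.
have -> : \sum_(i < n) ((bump 0 i)%:R + c) ^+ 2 * g ^+ (bump 0 i) =
    g * \sum_(i < n) (i%:R + (c + 1)) ^+ 2 * g ^+ i.
  rewrite mulr_sumr; apply: eq_bigr => i _.
  by rewrite /bump leq0n add1n (exprS g) -natr1; ring.
apply: (@le_trans _ _ (c ^+ 2 + g * ((c + 1) ^+ 2 / (1 - g) +
    2 * (c + 1) * g / (1 - g) ^+ 2 + g * (1 + g) / (1 - g) ^+ 3))).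
  by rewrite lerD2l ler_wpM2l ?IH ?addr_ge0// ltW.
by rewrite le_eqVlt; apply/orP; left; apply/eqP; field; rewrite gt_eqF.
Qed.

Lemma ler_sum_prefix H k (c : R) (F : 'I_H -> R) : (k <= H)%N ->
  (forall i : 'I_H, F i <= c) -> \sum_(i < H | (i < k)%N) F i <= k%:R * c.
Proof.
move=> kH Fc; rewrite (big_ord_narrow kH).
apply: (le_trans (ler_sum _ (fun i _ => Fc _))).
by rewrite sumr_const card_ord mulr_natl.
Qed.

End real_bounds.

(* A first-order bound with a uniform constant for small increments extends to
   all increments: comparing the expansions at [x] and [x + v] controls the
   variation of [g], and the constant survives doubling the increment. *)
Lemma quadratic_bound_globalize (R : realType) d (f : 'rV[R]_d -> R)
    (g : 'rV[R]_d -> 'rV[R]_d) (L s : R) : 0 < s ->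
  (forall x v, l2norm v <= s ->
    `|f (x + v) - f x - dot (g x) v| <= L * l2norm v ^+ 2) ->
  forall x v, `|f (x + v) - f x - dot (g x) v| <= L * l2norm v ^+ 2.
Proof.
move=> s0 fs.
have double t : (forall x v, l2norm v <= t ->
    `|f (x + v) - f x - dot (g x) v| <= L * l2norm v ^+ 2) ->
  forall x v, l2norm v <= 2 * t ->
    `|f (x + v) - f x - dot (g x) v| <= L * l2norm v ^+ 2.
  move=> ft x v vt; pose u := 2^-1 *: v.
  have -> : v = u + u by rewrite /u -scalerDl -[LHS]scale1r; congr (_ *: _); lra.
  have ut : l2norm u <= t.
    by rewrite /u l2normZ ger0_norm ?invr_ge0//; lra.
  (* Together [a1] and [a3] give |<g (x + u) - g x, u>| <= 2 L |u|^2. Adding [a1] and [a2] yields 4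
     L |u|^2 = L |u + u|^2, so the constant does not grow. *)
  have a1 := ft x u ut; have a2 := ft (x + u) u ut.
  have a3 := ft (x + u) (- u); rewrite l2normN addrK in a3.
  have {}a3 := a3 ut.
  have -> : l2norm (u + u) ^+ 2 = 4 * l2norm u ^+ 2.
    by rewrite !l2norm_sq !dotE; ring.
  rewrite addrA; move: a1 a2 a3; rewrite !dotE !ler_norml.
  by move=> /andP[? ?] /andP[? ?] /andP[? ?]; apply/andP; split; lra.
have main n x v : l2norm v <= 2 ^+ n * s ->
    `|f (x + v) - f x - dot (g x) v| <= L * l2norm v ^+ 2.
  elim: n x v => [|n IH] x v; first by rewrite mul1r; exact: fs.
  by rewrite exprS -mulrA; apply: double.
move=> x v.
have [n hn] : exists n : nat, l2norm v <= 2 ^+ n * s.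
  exists (Num.truncn (l2norm v / s)).+1.
  rewrite -ler_pdivrMr//; apply: (le_trans (ltW (truncnS_gt _))).
  by rewrite -natrX ler_nat ltnW// ltn_expl.
exact: main hn.
Qed.

Lemma l2norm_sq_sum (R : realType) d n (F : 'I_n -> 'rV[R]_d) :
  l2norm (\sum_i F i) ^+ 2 <= n%:R * \sum_i l2norm (F i) ^+ 2.
Proof.
apply: (@le_trans _ _ ((\sum_i l2norm (F i)) ^+ 2)).
  rewrite lerXn2r ?nnegrE ?l2norm_ge0 ?l2norm_sum// sumr_ge0// => i _.
  exact: l2norm_ge0.
pose u : 'rV[R]_n := \row_i l2norm (F i).
have uE : \sum_i l2norm (F i) = dot u (const_mx 1).
  by apply: eq_bigr => i _; rewrite !mxE mulr1.
rewrite uE -(@real_normK _ (dot _ _)) ?num_real//.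
have -> : n%:R * \sum_i l2norm (F i) ^+ 2 =
    (l2norm u * l2norm (const_mx 1 : 'rV[R]_n)) ^+ 2.
  rewrite exprMn !l2norm_sq mulrC; congr (_ * _).
    by apply: eq_bigr => i _; rewrite mxE expr2.
  rewrite /dot; under eq_bigr do rewrite mxE mulr1.
  by rewrite sumr_const card_ord.
by rewrite lerXn2r ?nnegrE ?mulr_ge0 ?l2norm_ge0// cauchy_schwarz.
Qed.

Lemma derive_quadratic_bound (R : realType) d (f : 'rV[R]_d -> R)
    (x v : 'rV[R]_d) (m K : R) : 0 < K ->
  (forall t, `|f (t *: v + x) - f x - t * m| <= K * t ^+ 2) -> 'D_v f x = m.
Proof.
move=> K0 h; apply: cvg_lim => //; apply/cvgrPdist_le => eps eps0.
near=> t.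
have t0 : t != 0 by near: t; exact: nbhs_dnbhs_neq.
have tK : `|t| <= eps / K by near: t; apply: dnbhs0_le; rewrite divr_gt0.
have -> : m - t^-1 *: ((f \o shift x) (t *: v) - f x) =
    t^-1 * - (f (t *: v + x) - f x - t * m).
  by rewrite /= /GRing.scale/=; field.
rewrite normrM normrN normfV ler_pdivrMl ?normr_gt0//.
apply: (le_trans (h t)); rewrite -(@real_normK _ t) ?num_real// expr2 mulrA.
by rewrite mulrC ler_wpM2l// mulrC -ler_pdivlMr.
Unshelve. all: by end_near.
Qed.

(** The hypothesis makes [f - g] orthogonal to [g], so the mean of (f - g)^2 is the difference of
    the two second moments. It stands in for the contraction property of conditional expectation. *)
Lemma ler_mean_sqr d (T : measurableType d) (R : realType)
    (P : probability T R) (f g : T -> R) : bmeas f -> bmeas g ->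
  mean P (fun x => f x * g x) = mean P (fun x => g x * g x) ->
  mean P (fun x => g x ^+ 2) <= mean P (fun x => f x ^+ 2).
Proof.
move=> bf bg fg; have bff := bmeasX 2 bf; have bgg := bmeasX 2 bg.
have : 0 <= mean P (fun x => (f x - g x) ^+ 2).
  by apply: mean_ge0 => x; exact: sqr_ge0.
have -> : (fun x => (f x - g x) ^+ 2) =
    (fun x => f x ^+ 2 + g x ^+ 2 - 2 * (f x * g x)).
  by apply/funext => x; ring.
rewrite (meanB _ (bmeasD bff bgg) (bmeasZ 2 (bmeasM bf bg))) (meanD _ bff bgg).
rewrite (meanZ _ 2 (bmeasM bf bg)) fg.
by have -> : (fun x => g x * g x) = (fun x => g x ^+ 2)
  by [apply/funext => x; rewrite expr2]; lra.
Qed.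

(** Extends a change of measure from nonnegative to signed bounded functions: a constant [c] makes
    [f] nonnegative, and since [rho] has mass 1 it contributes [c] on both sides. *)
Lemma mean_density d (T : measurableType d) (R : realType)
    (P P' : probability T R) (rho f : T -> R) : bmeas rho -> bmeas f ->
  (\int[P]_x (rho x)%:E = 1)%E ->
  (forall c : R, (forall x, 0 <= f x + c)%R ->
    \int[P]_x ((rho x)%:E * (f x + c)%:E) = \int[P']_x (f x + c)%:E)%E ->
  mean P (fun x => rho x * f x) = mean P' f.
Proof.
move=> br bf r1 rf; have [c fc] := bf.2.
have bc : bmeas (cst c : T -> R) by exact: bmeas_cst.
have f0 x : 0 <= f x + c by have := fc x; rewrite ler_norml => /andP[]; lra.
have r1' : mean P rho = 1 by apply: EFin_inj; rewrite -EFin_mean.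
have h1 : mean P (fun x => rho x * (f x + c)) = mean P' (fun x => f x + c).
  apply: EFin_inj; rewrite -!EFin_mean//; [|exact: bmeasD|].
    by under eq_integral do rewrite EFinM; exact: rf.
  by apply: bmeasM => //; exact: bmeasD.
have h2 : mean P (fun x => rho x * (f x + c)) =
    mean P (fun x => rho x * f x) + c.
  under [in LHS]eq_fun do rewrite mulrDr (mulrC _ c).
  by rewrite meanD ?meanZ ?r1' ?mulr1//; [exact: bmeasM|exact: bmeasZ].
by move: h1; rewrite h2 meanD// mean_cst; apply: addIr.
Qed.

Section policy_smoothness.
Context dS dA (S : measurableType dS) (A : measurableType dA) {R : realType}
  (nu : {sigma_finite_measure set A -> \bar R}) (d : nat)
  (D : mdp S A R) (pol : policy_class S nu d).
Variables (Rmax G M W : R).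
Local Notation H := (horizon D).
Local Notation r := (reward D).
Local Notation gamma := (discount D).
Local Notation law := (traj_law D pol).
Implicit Types (th v : 'rV[R]_d) (tau : traj S A H).

Hypothesis rewardP : forall sa, - Rmax <= r sa <= Rmax.
Hypothesis gammaP : 0 < gamma < 1.
Hypothesis G_gt0 : 0 < G.
Hypothesis M_gt0 : 0 < M.
Hypothesis Rmax_gt0 : 0 < Rmax.
Hypothesis pol2 : forall sa, twice_differentiable (log_pi pol sa).
Hypothesis polG : forall th sa, l2norm (grad (log_pi pol sa) th) <= G.
Hypothesis polM : forall th sa, spectral_norm (hessian (log_pi pol sa) th) <= M.
Hypothesis polW : forall th1 th2, ('V_(law th2)[fun tau =>
  (likelihood pol th1 tau / likelihood pol th2 tau)%R] <= W%:E)%E.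

Let G_ge0 : 0 <= G := ltW G_gt0.
Let M_ge0 : 0 <= M := ltW M_gt0.
Let Rmax_ge0 : 0 <= Rmax := ltW Rmax_gt0.

Definition Lsmooth : R := M * Rmax / (1 - gamma) ^+ 2
                    + 2 * G ^+ 2 * Rmax / (1 - gamma) ^+ 3.

Lemma normr_reward sa : `|r sa| <= Rmax.
Proof. by rewrite ler_norml rewardP. Qed.

Lemma measurable_log_pi th : measurable_fun setT (fun sa => log_pi pol sa th).
Proof. exact: (measurableT_comp (@measurable_ln R) (measurable_pi pol th)). Qed.

(** A partial derivative is the pointwise limit of the difference quotients with steps 1/(n+1), and
    each of these is measurable in the state-action pair. *)
Lemma measurable_grad_log_pi th i :
  measurable_fun setT (fun sa => grad (log_pi pol sa) th ord0 i).
Proof.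
pose e : 'rV[R]_d := delta_mx ord0 i.
pose h (n : nat) (sa : S * A) : R :=
  (n.+1%:R^-1)^-1 * (log_pi pol sa (n.+1%:R^-1 *: e + th) - log_pi pol sa th).
apply: (measurable_fun_cvg (h := h)) => [n|sa _].
  apply: measurable_funM; first exact: measurable_cst.
  by apply: measurable_funB; exact: measurable_log_pi.
rewrite mxE.
have df : derivable (log_pi pol sa) th e by apply: diff_derivable; exact: (pol2 sa).1.
have hs : (n.+1%:R^-1 : R) @[n --> \oo] --> (0 : R)^'.
  move=> U hU; have hn : \forall n \near \oo,
    (n.+1%:R^-1 != 0 :> R -> U n.+1%:R^-1) := @cvg_harmonic R _ hU.
  suff : \forall n \near \oo, U (n.+1%:R^-1 : R) by [].
  by apply: filterS hn => n; apply; rewrite invr_neq0.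
exact: (cvg_comp _ _ hs df).
Qed.

Lemma bmeas_step (f : S * A -> R) (i : 'I_H) c : measurable_fun setT f ->
  (forall sa, `|f sa| <= c) -> bmeas (fun tau => f (step tau i)).
Proof.
move=> mf fc; split; last by exists c => tau.
exact: (measurableT_comp mf (measurable_tau_step i)).
Qed.

Definition score k th tau : 'rV[R]_d :=
  \sum_(i < H | (i < k)%N) grad (log_pi pol (step tau i)) th.

Definition log_ratio k th' th tau : R :=
  \sum_(i < H | (i < k)%N)
    (log_pi pol (step tau i) th' - log_pi pol (step tau i) th).

Lemma prefix_ratioE k th' th tau :
  prefix_ratio pol th' th k tau = expR (log_ratio k th' th tau).
Proof.
rewrite /log_ratio expR_sum; apply: eq_bigr => i _.
by rewrite expRB /log_pi !lnK ?posrE ?policy_gt0.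
Qed.

Lemma l2norm_score k th tau : (k <= H)%N -> l2norm (score k th tau) <= k%:R * G.
Proof.
move=> kH; apply: (le_trans (l2norm_sum _ _ _)).
by apply: (@ler_sum_prefix _ H k G (fun i => l2norm (grad _ th))).
Qed.

Lemma l2norm_scoreB k th v tau : (k <= H)%N ->
  l2norm (score k (th + v) tau - score k th tau) <= k%:R * (M * l2norm v).
Proof.
move=> kH; rewrite /score -sumrB; apply: (le_trans (l2norm_sum _ _ _)).
apply: (@ler_sum_prefix _ H k (M * l2norm v) (fun i => l2norm (_ - grad _ th))) => // i.
exact: lipschitz_hessian.
Qed.

Lemma normr_log_ratio k th v tau : (k <= H)%N ->
  `|log_ratio k (th + v) th tau| <= k%:R * (G * l2norm v).
Proof.
move=> kH; apply: (le_trans (ler_norm_sum _ _ _)).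
apply: (@ler_sum_prefix _ H k (G * l2norm v) (fun i => `|_ - log_pi pol _ th|)) => // i.
exact: lipschitz_grad.
Qed.

Lemma log_ratio_taylor k th v tau : (k <= H)%N ->
  `|log_ratio k (th + v) th tau - dot (score k th tau) v| <=
  k%:R * (M * l2norm v ^+ 2).
Proof.
move=> kH; rewrite /log_ratio /score dot_suml -sumrB.
apply: (le_trans (ler_norm_sum _ _ _)).
apply: (@ler_sum_prefix _ H k (M * l2norm v ^+ 2)
  (fun i => `|_ - dot (grad _ th) v|)) => // i.
exact: taylor_hessian.
Qed.

(** The term k^2 G^2 is the remainder of the exponential at the log-ratio; the term k M is the
    remainder of the log-ratio itself. *)
Lemma prefix_ratio_taylor k th v tau : (k <= H)%N ->
  k%:R * (G * l2norm v) <= 3^-1 ->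
  `|prefix_ratio pol (th + v) th k tau - 1 - dot (score k th tau) v| <=
  (k%:R ^+ 2 * G ^+ 2 + k%:R * M) * l2norm v ^+ 2.
Proof.
move=> kH hv; rewrite prefix_ratioE.
set x := log_ratio _ _ _ _; set y := dot _ _.
have -> : expR x - 1 - y = (expR x - 1 - x) + (x - y) by ring.
apply: (le_trans (ler_normD _ _)).
have hx : `|x| <= k%:R * (G * l2norm v) by exact: normr_log_ratio.
have h1 : `|expR x - 1 - x| <= x ^+ 2 by apply: expR_taylor2; exact: le_trans hv.
have h2 : `|x - y| <= k%:R * (M * l2norm v ^+ 2) by exact: log_ratio_taylor.
have h3 : x ^+ 2 <= (k%:R * (G * l2norm v)) ^+ 2.
  rewrite -(@real_normK _ x) ?num_real// lerXn2r ?nnegrE//.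
  exact: le_trans hx.
apply: (le_trans (lerD (le_trans h1 h3) h2)).
by rewrite !exprMn; rewrite le_eqVlt; apply/orP; left; apply/eqP; ring.
Qed.

Lemma bmeas_prefix_ratio k th' th : (k <= H)%N ->
  bmeas (fun tau => prefix_ratio pol th' th k tau).
Proof.
move=> kH; split; first exact: measurable_prefix_ratio.
exists (expR (k%:R * (G * l2norm (th' - th)))) => tau.
rewrite prefix_ratioE ger0_norm ?expR_ge0// ler_expR.
apply: (le_trans (ler_norm _)).
by rewrite -{1}(subrK th th') addrC; exact: normr_log_ratio.
Qed.

Lemma bmeas_score k th i : bmeas (fun tau => score k th tau ord0 i).
Proof.
rewrite (_ : (fun _ => _) = (fun tau => \sum_(j < H | (j < k)%N)
    grad (log_pi pol (step tau j)) th ord0 i)); last first.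
  by apply/funext => tau; rewrite /score summxE.
apply: bmeas_sum => j _.
apply: (@bmeas_step (fun sa => grad (log_pi pol sa) th ord0 i) j G) => //.
  exact: measurable_grad_log_pi.
by move=> sa; exact: le_trans (ler_coord_l2norm _ _) (polG _ _).
Qed.

Lemma bmeas_reward (h : 'I_H) : bmeas (fun tau => r (step tau h)).
Proof.
apply: (@bmeas_step r h Rmax) => //; first exact: measurable_reward.
exact: normr_reward.
Qed.

Lemma mean_change_of_measure k th' th (f : traj S A H -> R) : (k <= H)%N ->
  bmeas f -> prefix_fun k f ->
  mean (law th) (fun tau => prefix_ratio pol th' th k tau * f tau) =
  mean (law th') f.
Proof.
move=> kH bf pf.
have r1 : (\int[law th]_tau (prefix_ratio pol th' th k tau)%:E = 1)%E.
  transitivity (\int[law th]_tau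
      ((prefix_ratio pol th' th k tau)%:E * cst 1 tau))%E.
    by apply: eq_integral => tau _; rewrite mule1.
  rewrite (@change_of_measure _ _ S A R nu d D pol th' th k (cst 1%E))//.
  by rewrite integral_cst// mul1e; exact: probability_setT.
apply: (mean_density (bmeas_prefix_ratio th' th kH) bf r1) => c fc0.
apply: (@change_of_measure _ _ S A R nu d D pol th' th k
  (fun tau => (f tau + c)%:E)).
- by move=> tau; rewrite lee_fin.
- by apply/measurable_EFinP; apply: measurable_funD => //; case: bf.
- by move=> tau tau' h; rewrite (pf tau tau').
Qed.

Lemma prefix_funW U k k' (f : traj S A H -> U) : (k <= k')%N ->
  prefix_fun k f -> prefix_fun k' f.
Proof. by move=> kk' pf tau tau' h; apply: pf => i /leq_trans; auto. Qed.

Lemma prefix_fun_ratio k th' th :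
  prefix_fun k (@prefix_ratio _ _ S A R nu d pol th' th H k).
Proof. by move=> tau tau' h; apply: eq_bigr => i ik; rewrite h. Qed.

Lemma prefix_fun_score k th : prefix_fun k (score k th).
Proof. by move=> tau tau' h; apply: eq_bigr => i ik; rewrite /step h. Qed.

Lemma prefix_fun_reward (h : 'I_H) : prefix_fun h.+1 (fun tau => r (step tau h)).
Proof. by move=> tau tau' e; rewrite /step e. Qed.

Lemma performanceE th : performance D pol th =
  \sum_(h < H) gamma ^+ h * mean (law th) (fun tau => r (step tau h)).
Proof.
rewrite /performance expectation_mean; last first.
  by apply: bmeas_sum => h _; apply: bmeasZ; exact: bmeas_reward.
rewrite [LHS]/= mean_sum; last by move=> h _; apply: bmeasZ; exact: bmeas_reward.
by apply: eq_bigr => h _; rewrite meanZ//; exact: bmeas_reward.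
Qed.

Lemma performance_change_of_measure th' th : performance D pol th' =
  \sum_(h < H) gamma ^+ h * mean (law th)
    (fun tau => prefix_ratio pol th' th h.+1 tau * r (step tau h)).
Proof.
rewrite performanceE; apply: eq_bigr => h _.
apply: (congr1 (fun x => gamma ^+ h * x)); apply: esym.
exact: (mean_change_of_measure th' th (ltn_ord h) (bmeas_reward h)
  (@prefix_fun_reward h)).
Qed.

(** Holds by conversion, [(t < h.+1)%N] being convertible to [(t <= h)%N]. *)
Lemma pg_estimatorE th tau : pg_estimator pol th tau =
  \sum_(h < H) (gamma ^+ h * r (step tau h)) *: score h.+1 th tau.
Proof. by []. Qed.

Lemma is_pg_estimatorE th' th tau : is_pg_estimator pol th' th tau =
  \sum_(h < H) (prefix_ratio pol th' th h.+1 tau * gamma ^+ h * r (step tau h)) *: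
    score h.+1 th' tau.
Proof. by []. Qed.

Definition mean_pg th : 'rV[R]_d := vmean (law th) (pg_estimator pol th).

Lemma bmeas_pg_estimator th i :
  bmeas (fun tau => pg_estimator pol th tau ord0 i).
Proof.
under [X in bmeas X]eq_fun do rewrite pg_estimatorE summxE.
apply: bmeas_sum => h _; under [X in bmeas X]eq_fun do rewrite mxE.
by apply: bmeasM; [apply: bmeasZ; exact: bmeas_reward|exact: bmeas_score].
Qed.

Lemma bmeas_is_pg_estimator th' th i :
  bmeas (fun tau => is_pg_estimator pol th' th tau ord0 i).
Proof.
under [X in bmeas X]eq_fun do rewrite is_pg_estimatorE summxE.
apply: bmeas_sum => h _; under [X in bmeas X]eq_fun do rewrite mxE.
apply: bmeasM; last exact: bmeas_score.
apply: bmeasM; last exact: bmeas_reward.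
by apply: bmeasM; [exact: bmeas_prefix_ratio|exact: bmeas_cst].
Qed.

Lemma mean_pgE th i : mean_pg th ord0 i =
  mean (law th) (fun tau => pg_estimator pol th tau ord0 i).
Proof. by rewrite mxE expectation_mean//; exact: bmeas_pg_estimator. Qed.

Lemma bmeas_dot_score k th v : bmeas (fun tau => dot (score k th tau) v).
Proof. by apply: bmeas_dot => i; [exact: bmeas_score|exact: bmeas_cst]. Qed.

Lemma dot_mean_pg th v : dot (mean_pg th) v = \sum_(h < H) gamma ^+ h *
  mean (law th) (fun tau => r (step tau h) * dot (score h.+1 th tau) v).
Proof.
transitivity (mean (law th) (fun tau => dot (pg_estimator pol th tau) v)).
  rewrite /dot mean_sum => [|i _]; last first.
    by apply: bmeasM; [exact: bmeas_pg_estimator|exact: bmeas_cst].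
  apply: eq_bigr => i _; rewrite mean_pgE mulrC -meanZ; last first.
    exact: bmeas_pg_estimator.
  by congr mean; apply/funext => tau; rewrite mulrC.
have b h : bmeas (fun tau => r (step tau h) * dot (score h.+1 th tau) v).
  by apply: bmeasM; [exact: bmeas_reward|exact: bmeas_dot_score].
transitivity (mean (law th) (fun tau => \sum_(h < H) gamma ^+ h *
    (r (step tau h) * dot (score h.+1 th tau) v))).
  congr mean; apply/funext => tau; rewrite pg_estimatorE dot_suml.
  by apply: eq_bigr => h _; rewrite dotZl mulrA.
rewrite mean_sum => [|h _]; last exact: bmeasZ.
by apply: eq_bigr => h _; rewrite meanZ.
Qed.

(** The h-th weight covers exactly the [h.+1] steps on which the h-th summand depends, so each
    summand changes measure on its own. *)
Lemma mean_is_pg_estimator th' th i :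
  mean (law th) (fun tau => is_pg_estimator pol th' th tau ord0 i) =
  mean_pg th' ord0 i.
Proof.
have b (h : 'I_H) :
    bmeas (fun tau => gamma ^+ h * r (step tau h) * score h.+1 th' tau ord0 i).
  by apply: bmeasM; [apply: bmeasZ; exact: bmeas_reward|exact: bmeas_score].
transitivity (\sum_(h < H) mean (law th')
    (fun tau => gamma ^+ h * r (step tau h) * score h.+1 th' tau ord0 i)).
  transitivity (mean (law th) (fun tau => \sum_(h < H)
      prefix_ratio pol th' th h.+1 tau *
      (gamma ^+ h * r (step tau h) * score h.+1 th' tau ord0 i))).
    congr mean; apply/funext => tau; rewrite is_pg_estimatorE summxE.
    by apply: eq_bigr => h _; rewrite mxE !mulrA.
  rewrite mean_sum => [|h _]; last first.
    by apply: bmeasM => //; exact: bmeas_prefix_ratio.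
  apply: eq_bigr => h _.
  apply: (mean_change_of_measure th' th (ltn_ord h) (b h)) => tau tau' e.
  by rewrite (prefix_fun_score _ e) (prefix_fun_reward e).
rewrite mean_pgE -mean_sum//; congr mean; apply/funext => tau.
rewrite pg_estimatorE summxE; by apply: eq_bigr => h _; rewrite mxE.
Qed.

(** The full series of (h+1) gamma^h and (h+1)^2 gamma^h are 1/(1-gamma)^2 and
    (1+gamma)/(1-gamma)^3; with 1 + gamma <= 2 they produce the two terms of [Lsmooth]. *)
Lemma sum_taylor_constants : \sum_(h < H) gamma ^+ h *
  (Rmax * (h.+1%:R ^+ 2 * G ^+ 2 + h.+1%:R * M)) <= Lsmooth.
Proof.
have /andP[g0 g1] := gammaP; have ap : 0 < 1 - gamma by lra.
have s1 := sum_arith_geometric H gammaP (@ler01 R).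
have s2 := sum_sqr_geometric H gammaP (@ler01 R).
have -> : \sum_(h < H) gamma ^+ h *
    (Rmax * (h.+1%:R ^+ 2 * G ^+ 2 + h.+1%:R * M)) =
    Rmax * G ^+ 2 * (\sum_(h < H) (h%:R + 1) ^+ 2 * gamma ^+ h) +
    Rmax * M * (\sum_(h < H) (h%:R + 1) * gamma ^+ h).
  rewrite !mulr_sumr -big_split/=; apply: eq_bigr => h _.
  by rewrite -natr1; ring.
apply: (@le_trans _ _ (Rmax * G ^+ 2 * (2 / (1 - gamma) ^+ 3) +
    Rmax * M * (1 / (1 - gamma) ^+ 2))); last first.
  by rewrite /Lsmooth le_eqVlt; apply/orP; left; apply/eqP; ring.
have E1 : 1 / (1 - gamma) + gamma / (1 - gamma) ^+ 2 = 1 / (1 - gamma) ^+ 2.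
  by field; rewrite gt_eqF.
have E2 : 1 ^+ 2 / (1 - gamma) + 2 * 1 * gamma / (1 - gamma) ^+ 2 +
    gamma * (1 + gamma) / (1 - gamma) ^+ 3 = (1 + gamma) / (1 - gamma) ^+ 3.
  by field; rewrite gt_eqF.
rewrite E1 in s1; rewrite E2 in s2.
apply: lerD; rewrite ler_wpM2l//.
- by rewrite mulr_ge0 ?sqr_ge0// ltW.
- by apply: (le_trans s2); rewrite ler_wpM2r ?invr_ge0 ?exprn_ge0 ?ltW//; lra.
- by rewrite mulr_ge0// ltW.
Qed.

Lemma Lsmooth_gt0 : 0 < Lsmooth.
Proof.
have /andP[g0 g1] := gammaP; have ap : 0 < 1 - gamma by lra.
by rewrite /Lsmooth addr_gt0// divr_gt0 ?exprn_gt0// !mulr_gt0// exprn_gt0.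
Qed.

(* The usual argument gives [Lsmooth / 2]; the step size [1 / (4 * Lsmooth)] leaves
   room for the factor 2. *)
Lemma smooth_mean_pg th v :
  `|performance D pol (th + v) - performance D pol th - dot (mean_pg th) v| <=
  Lsmooth * l2norm v ^+ 2.
Proof.
(* This radius forces H G |v| <= 1/3, as [prefix_ratio_taylor] requires for every prefix; the added
   1 keeps the denominator positive. *)
apply: (@quadratic_bound_globalize R d _ mean_pg Lsmooth (3 * (H%:R * G + 1))^-1).
  by rewrite invr_gt0 mulr_gt0// ltr_wpDl// mulr_ge0// ltW.
move=> {}th {}v vs.
(* Moving the value at [th + v] to the law of [th] puts all three terms under one mean, where the
   pointwise expansion applies. *)
rewrite (performance_change_of_measure (th + v) th) performanceE dot_mean_pg.
rewrite -!sumrB; apply: (le_trans (ler_norm_sum _ _ _)).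
apply: (le_trans _ (ler_wpM2r (sqr_ge0 _) sum_taylor_constants)).
rewrite mulr_suml; apply: ler_sum => h _.
have br := bmeas_reward h.
have bpr : bmeas (fun tau => prefix_ratio pol (th + v) th h.+1 tau *
    r (step tau h)) by apply: bmeasM => //; exact: bmeas_prefix_ratio.
have brs : bmeas (fun tau => r (step tau h) * dot (score h.+1 th tau) v).
  by apply: bmeasM => //; exact: bmeas_dot_score.
have gh0 : 0 <= gamma ^+ h by have /andP[g0 _] := gammaP; rewrite exprn_ge0// ltW.
rewrite -!mulrBr -(meanB _ bpr br) -(meanB _ (bmeasB bpr br) brs).
rewrite normrM (ger0_norm gh0) -mulrA (ler_wpM2l gh0)//; apply: ler_norm_mean.
  by apply: bmeasB => //; exact: bmeasB.
move=> tau.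
have -> : prefix_ratio pol (th + v) th h.+1 tau * r (step tau h) -
    r (step tau h) - r (step tau h) * dot (score h.+1 th tau) v =
    r (step tau h) * (prefix_ratio pol (th + v) th h.+1 tau - 1 -
      dot (score h.+1 th tau) v) by ring.
rewrite normrM -mulrA; apply: ler_pM => //; first exact: normr_reward.
apply: prefix_ratio_taylor; first exact: ltn_ord.
have hH : h.+1%:R * (G * l2norm v) <= H%:R * (G * l2norm v).
  by rewrite ler_wpM2r ?ler_nat ?ltn_ord// mulr_ge0 ?l2norm_ge0// ltW.
apply: (le_trans hH).
have kp : 0 < H%:R * G + 1 :> R by rewrite ltr_wpDl// mulr_ge0// ltW.
have {}vs : l2norm v * (3 * (H%:R * G + 1)) <= 1.
  by rewrite -ler_pdivlMr ?mulr_gt0// div1r.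
by have := l2norm_ge0 v; lra.
Qed.

Lemma grad_performance th : grad (performance D pol) th = mean_pg th.
Proof.
apply/rowP => i; rewrite mxE; apply: (derive_quadratic_bound Lsmooth_gt0) => t.
have := smooth_mean_pg th (t *: delta_mx ord0 i).
rewrite (addrC th) l2normZ l2norm_delta mulr1 real_normK ?num_real//.
by rewrite dotZr dot_delta => ht; exact: ht.
Qed.

(** * Second moments of likelihood ratios and of estimator differences *)

Lemma mean_prefix_ratio k th' th : (k <= H)%N ->
  mean (law th) (fun tau => prefix_ratio pol th' th k tau) = 1.
Proof.
move=> kH; have b1 : bmeas (cst 1 : traj S A H -> R) by exact: bmeas_cst.
have p1 : prefix_fun k (cst 1 : traj S A H -> R) by [].
apply: etrans (etrans (mean_change_of_measure th' th kH b1 p1) (mean_cst _ 1)).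
by apply: (congr1 (mean (law th))); apply/funext => tau; rewrite mulr1.
Qed.

(** (A3) concerns whole trajectories, while the estimator uses prefixes. Under the law of [th], the
    full ratio times the prefix ratio and the prefix ratio squared have the same mean, namely that
    of the prefix ratio under [th']; so the prefix has the smaller second moment. *)
Lemma mean_sqr_prefix_ratio k th' th : (k <= H)%N ->
  mean (law th) (fun tau => prefix_ratio pol th' th k tau ^+ 2) <=
  mean (law th) (fun tau => prefix_ratio pol th' th H tau ^+ 2).
Proof.
move=> kH; have bk := bmeas_prefix_ratio th' th kH.
have bH := bmeas_prefix_ratio th' th (leqnn H).
have pk := @prefix_fun_ratio k th' th.
have pH := prefix_funW kH pk.
apply: (ler_mean_sqr bH bk).
apply: etrans (mean_change_of_measure th' th (leqnn H) bk pH) _.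
exact: esym (mean_change_of_measure th' th kH bk pk).
Qed.

Lemma mean_sqr_prefix_ratioB1 k th' th : (k <= H)%N ->
  mean (law th) (fun tau => (prefix_ratio pol th' th k tau - 1) ^+ 2) =
  mean (law th) (fun tau => prefix_ratio pol th' th k tau ^+ 2) - 1.
Proof.
move=> kH; have bk := bmeas_prefix_ratio th' th kH.
have -> : (fun tau => (prefix_ratio pol th' th k tau - 1) ^+ 2) =
    (fun tau => prefix_ratio pol th' th k tau ^+ 2 +
      (-2 * prefix_ratio pol th' th k tau + cst 1 tau)).
  by apply/funext => tau /=; ring.
have b1 := bmeas_cst (traj S A H) (1 : R).
rewrite (meanD _ (bmeasX 2 bk) (bmeasD (bmeasZ (-2) bk) b1)).
rewrite (meanD _ (bmeasZ (-2) bk) b1) mean_cst (meanZ _ (-2) bk).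
rewrite (mean_prefix_ratio th' th kH); ring.
Qed.

Lemma mean_sqr_likelihood_ratio th' th :
  mean (law th) (fun tau => (prefix_ratio pol th' th H tau - 1) ^+ 2) <= W.
Proof.
have := polW th' th.
have -> : (fun tau => likelihood pol th' tau / likelihood pol th tau) =
    (fun tau => prefix_ratio pol th' th H tau).
  apply/funext => tau; rewrite /likelihood -prodf_div /prefix_ratio.
  by apply: eq_big => [i|i _]; rewrite ?ltn_ord.
have bH := bmeas_prefix_ratio th' th (leqnn H).
rewrite /variance unlock (expectation_mean _ bH) (mean_prefix_ratio th' th (leqnn H)).
have b1 := bmeas_cst (traj S A H) (1 : R).
rewrite [X in (X <= _)%E](_ : _ = (mean (law th) (fun tau =>
    (prefix_ratio pol th' th H tau - 1) ^+ 2))%:E) ?lee_fin//.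
rewrite -expectation_mean; last exact: bmeasX (bmeasB bH b1).
by congr expectation; apply/funext => tau; rewrite /= expr2.
Qed.

(** The first summand serves |v| <= 1, where |exp x - 1| is at most exp(H G) H G |v|; the second
    serves |v| > 1, where W <= W |v|^2. *)
Definition Cratio : R := (expR (H%:R * G) * (H%:R * G)) ^+ 2 + W.

Lemma mean_sqr_prefix_ratio_le k th v : (k <= H)%N ->
  mean (law th) (fun tau => (prefix_ratio pol (th + v) th k tau - 1) ^+ 2) <=
  Cratio * l2norm v ^+ 2.
Proof.
move=> kH.
have W0 : 0 <= W.
  by apply: le_trans (mean_sqr_likelihood_ratio th th); apply: mean_ge0 => ?;
    exact: sqr_ge0.
have HG0 : 0 <= H%:R * G by rewrite mulr_ge0// ltW.
have kHG : k%:R * G <= H%:R * G by rewrite ler_wpM2r ?ler_nat// ltW.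
have b1 := bmeas_cst (traj S A H) (1 : R).
have bk := bmeas_prefix_ratio (th + v) th kH.
have [v1|v1] := leP (l2norm v) 1.
  apply: (@le_trans _ _ ((expR (H%:R * G) * (H%:R * G)) ^+ 2 * l2norm v ^+ 2)).
    rewrite -[leRHS](mean_cst (law th)); apply: ler_mean.
    - exact: bmeasX (bmeasB bk b1).
    - exact: bmeas_cst.
    move=> tau; rewrite /= prefix_ratioE -exprMn.
    rewrite -(@real_normK _ (expR _ - 1)) ?num_real//.
    have hx : `|log_ratio k (th + v) th tau| <= k%:R * (G * l2norm v).
      exact: normr_log_ratio.
    have hx2 : `|log_ratio k (th + v) th tau| <= H%:R * G * l2norm v.
      by apply: (le_trans hx); rewrite mulrA ler_wpM2r// l2norm_ge0.
    have hx3 : `|log_ratio k (th + v) th tau| <= H%:R * G.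
      by apply: (le_trans hx2); rewrite ler_piMr.
    have := expR_sub1_le hx3 => hx4.
    rewrite lerXn2r ?nnegrE ?mulr_ge0 ?expR_ge0 ?l2norm_ge0//.
    by apply: (le_trans hx4); rewrite -mulrA ler_wpM2l ?expR_ge0.
  by rewrite ler_wpM2r ?sqr_ge0// lerDl.
apply: (@le_trans _ _ W).
  rewrite (mean_sqr_prefix_ratioB1 _ _ kH).
  apply: le_trans (mean_sqr_likelihood_ratio (th + v) th).
  by rewrite (mean_sqr_prefix_ratioB1 _ _ (leqnn H)) lerD2r mean_sqr_prefix_ratio.
have vv : 1 <= l2norm v ^+ 2 by rewrite exprn_ege1// ltW.
have := sqr_ge0 (expR (H%:R * G) * (H%:R * G)); rewrite /Cratio; nra.
Qed.

(** One factor H comes from squaring a sum of H vectors, the other from adding H equal bounds. The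
    bracket adds the variation of the score and that of the ratio, with gamma^h bounded by 1. *)
Definition Cdiff : R := H%:R ^+ 2 * Rmax ^+ 2 *
  (2 * (H%:R * M) ^+ 2 + 2 * (H%:R * G) ^+ 2 * Cratio).

Lemma l2norm_sq_estimatorB th v tau :
  l2norm (pg_estimator pol th tau - is_pg_estimator pol (th + v) th tau) ^+ 2 <=
  H%:R * \sum_(h < H) Rmax ^+ 2 * (2 * (H%:R * (M * l2norm v)) ^+ 2 +
    2 * (H%:R * G) ^+ 2 * (prefix_ratio pol (th + v) th h.+1 tau - 1) ^+ 2).
Proof.
have -> : pg_estimator pol th tau - is_pg_estimator pol (th + v) th tau =
    \sum_(h < H) (gamma ^+ h * r (step tau h)) *: (score h.+1 th tau -
      prefix_ratio pol (th + v) th h.+1 tau *: score h.+1 (th + v) tau).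
  rewrite pg_estimatorE is_pg_estimatorE -sumrB; apply: eq_bigr => h _.
  by rewrite scalerBr scalerA; congr (_ - _ *: _); ring.
apply: (le_trans (l2norm_sq_sum _)); rewrite ler_wpM2l// ler_sum// => h _.
rewrite l2normZ exprMn; apply: ler_pM; rewrite ?sqr_ge0//.
  rewrite lerXn2r ?nnegrE//.
  rewrite normrM -[leRHS]mul1r ler_pM ?normr_reward//.
  have /andP[g0 g1] := gammaP.
  by rewrite normrX exprn_ile1// ger0_norm// ltW.
(* The split isolates the change of the score, controlled by the Hessian bound, from the deviation
   of the ratio from 1, multiplied by a bounded score. *)
have -> : score h.+1 th tau -
      prefix_ratio pol (th + v) th h.+1 tau *: score h.+1 (th + v) tau =
    - ((score h.+1 (th + v) tau - score h.+1 th tau) +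
       (prefix_ratio pol (th + v) th h.+1 tau - 1) *: score h.+1 (th + v) tau).
  by rewrite scalerBl scale1r opprD opprB opprB addrA subrK.
have hH : h.+1%:R <= H%:R :> R by rewrite ler_nat.
rewrite l2normN; apply: (le_trans (l2normD_sq _ _)).
rewrite -mulrA; apply: lerD; rewrite ler_wpM2l//.
  rewrite lerXn2r ?nnegrE ?l2norm_ge0 ?mulr_ge0 ?l2norm_ge0//.
  apply: (le_trans (l2norm_scoreB _ _ _ (ltn_ord h))).
  by rewrite ler_wpM2r// mulr_ge0 ?l2norm_ge0// ltW.
rewrite l2normZ exprMn real_normK ?num_real// mulrC ler_wpM2r ?sqr_ge0//.
rewrite lerXn2r ?nnegrE ?l2norm_ge0 ?mulr_ge0//.
apply: (le_trans (l2norm_score _ _ (ltn_ord h))).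
by rewrite ler_wpM2r// ltW.
Qed.

Lemma bmeas_estimatorB th th' i : bmeas (fun tau =>
  (pg_estimator pol th tau - is_pg_estimator pol th' th tau) ord0 i).
Proof.
under [X in bmeas X]eq_fun do rewrite !mxE.
by apply: bmeasB; [exact: bmeas_pg_estimator|exact: bmeas_is_pg_estimator].
Qed.

Lemma mean_sq_estimatorB th v : mean (law th) (fun tau => l2norm
    (pg_estimator pol th tau - is_pg_estimator pol (th + v) th tau) ^+ 2) <=
  Cdiff * l2norm v ^+ 2.
Proof.
have b1 := bmeas_cst (traj S A H) (1 : R).
have bq (h : 'I_H) : bmeas (fun tau =>
    (prefix_ratio pol (th + v) th h.+1 tau - 1) ^+ 2).
  exact: bmeasX (bmeasB (bmeas_prefix_ratio _ _ (ltn_ord h)) b1).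
have bs (h : 'I_H) : bmeas (fun tau =>
    2 * (H%:R * (M * l2norm v)) ^+ 2 + 2 * (H%:R * G) ^+ 2 *
    (prefix_ratio pol (th + v) th h.+1 tau - 1) ^+ 2).
  by apply: bmeasD; [exact: bmeas_cst|exact: bmeasZ].
apply: (le_trans (ler_mean _ _ _ (l2norm_sq_estimatorB th v))).
- under [X in bmeas X]eq_fun do rewrite l2norm_sq.
  by apply: bmeas_dot => i; exact: bmeas_estimatorB.
- by apply: bmeasZ; apply: bmeas_sum => h _; exact: bmeasZ.
rewrite meanZ; last by apply: bmeas_sum => h _; exact: bmeasZ.
rewrite mean_sum => [|h _]; last exact: bmeasZ.
apply: (@le_trans _ _ (H%:R * \sum_(h < H) Rmax ^+ 2 *
    (2 * (H%:R * (M * l2norm v)) ^+ 2 + 2 * (H%:R * G) ^+ 2 *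
    (Cratio * l2norm v ^+ 2)))).
  rewrite ler_wpM2l// ler_sum// => h _; rewrite (meanZ _ _ (bs h)).
  rewrite ler_wpM2l ?sqr_ge0//.
  rewrite (meanD _ (bmeas_cst _ _) (bmeasZ _ (bq h))) mean_cst lerD2l.
  rewrite (meanZ _ _ (bq h)) ler_wpM2l ?mulr_ge0 ?sqr_ge0//.
  exact: mean_sqr_prefix_ratio_le (ltn_ord h).
rewrite sumr_const card_ord -mulr_natl /Cdiff.
by rewrite le_eqVlt; apply/orP; left; apply/eqP; ring.
Qed.

Lemma vmean_estimatorB th th' : vmean (law th)
    (fun tau => pg_estimator pol th tau - is_pg_estimator pol th' th tau) =
  mean_pg th - mean_pg th'.
Proof.
apply/rowP => i; rewrite mxE expectation_mean; last exact: bmeas_estimatorB.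
rewrite [LHS]/= [RHS]mxE [X in _ + X]mxE mean_pgE.
rewrite -(mean_is_pg_estimator th' th i).
rewrite -(meanB _ (bmeas_pg_estimator th i) (bmeas_is_pg_estimator th' th i)).
by apply: (congr1 (mean (law th))); apply/funext => tau; rewrite !mxE.
Qed.

End policy_smoothness.

(** * The potential argument *)

Section iid_average.
Context d (T : measurableType d) (R : realType) (P : probability T R) (n : nat).
Variable Z : T -> 'rV[R]_n.
Hypothesis bZ : forall i, bmeas (fun x => Z x ord0 i).
Local Notation mu := (vmean P Z).

Lemma vmeanE i : mu ord0 i = mean P (fun x => Z x ord0 i).
Proof. by rewrite mxE expectation_mean. Qed.

Lemma bmeas_centered i : bmeas (fun x => (Z x - mu) ord0 i).
Proof.
under [X in bmeas X]eq_fun do rewrite mxE.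
by apply: bmeasD => //; exact: bmeas_cst.
Qed.

Lemma mean_centered i : mean P (fun x => (Z x - mu) ord0 i) = 0.
Proof.
have -> : (fun x => (Z x - mu) ord0 i) = (fun x => Z x ord0 i - cst (mu ord0 i) x).
  by apply/funext => x; rewrite !mxE.
by rewrite (meanB _ (bZ i) (bmeas_cst _ _)) mean_cst vmeanE subrr.
Qed.

Lemma bmeas_sq_centered : bmeas (fun x => l2norm (Z x - mu) ^+ 2).
Proof.
under [X in bmeas X]eq_fun do rewrite l2norm_sq.
by apply: bmeas_dot => i; exact: bmeas_centered.
Qed.

Lemma mean_sq_centered_le :
  mean P (fun x => l2norm (Z x - mu) ^+ 2) <= mean P (fun x => l2norm (Z x) ^+ 2).
Proof.
have bc := bmeas_sq_centered.
have bd : bmeas (fun x => 2 * dot mu (Z x - mu)).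
  by apply/bmeasZ/bmeas_dot => i; [exact: bmeas_cst|exact: bmeas_centered].
have -> : (fun x => l2norm (Z x) ^+ 2) = (fun x => l2norm (Z x - mu) ^+ 2 +
    (2 * dot mu (Z x - mu) + cst (l2norm mu ^+ 2) x)).
  by apply/funext => x; rewrite /= !l2norm_sq !dotE (dotC mu (Z x)); ring.
have bn := bmeas_cst T (l2norm mu ^+ 2).
rewrite (meanD _ bc (bmeasD bd bn)) (meanD _ bd bn) mean_cst.
rewrite (meanZ _ 2); last first.
  by apply: bmeas_dot => i; [exact: bmeas_cst|exact: bmeas_centered].
rewrite /dot mean_sum => [|i _]; last by apply: bmeasZ; exact: bmeas_centered.
under eq_bigr do rewrite (meanZ _ _ (bmeas_centered _)) mean_centered mulr0.
by rewrite big1// mulr0 add0r lerDl sqr_ge0.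
Qed.

Lemma iid_average_second_moment k u c a : (0 < k)%N -> 0 <= c -> 0 <= a ->
  (\int[iid P k]_xs (c + a *
     l2norm (u + (k%:R^-1 *: \sum_(j < k) Z (tnth xs j) - mu)) ^+ 2)%:E =
   (c + a * (l2norm u ^+ 2 +
     k%:R^-1 * mean P (fun x => l2norm (Z x - mu) ^+ 2)))%:E)%E.
Proof.
move=> k0 c0 a0; have kn : k%:R != 0 :> R by rewrite pnatr_eq0 -lt0n.
(* With the factor 1/k inside, the centered average is a plain sum; k terms, each scaled by k^-2,
   leave 1/k. *)
pose Y x := k%:R^-1 *: (Z x - mu).
have bY i : bmeas (fun x => Y x ord0 i).
  under [X in bmeas X]eq_fun do rewrite mxE.
  by apply: bmeasZ; exact: bmeas_centered.
have Y0 i : mean P (fun x => Y x ord0 i) = 0.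
  under [X in mean _ X]eq_fun do rewrite mxE.
  by rewrite (meanZ _ _ (bmeas_centered i)) mean_centered mulr0.
have E xs : u + (k%:R^-1 *: \sum_(j < k) Z (tnth xs j) - mu) =
    u + \sum_(j < k) Y (tnth xs j).
  congr (u + _); rewrite /Y -scaler_sumr sumrB sumr_const card_ord scalerBr.
  by rewrite -(scaler_nat k mu) scalerA mulVf// scale1r.
have YE x : l2norm (Y x) ^+ 2 = k%:R^-1 ^+ 2 * l2norm (Z x - mu) ^+ 2.
  by rewrite l2normZ exprMn real_normK ?num_real.
under eq_integral do rewrite E.
apply: ge0_integral_affine => //.
- exact: probability_setT.
- exact: measurable_sq_iid_sum.
- by move=> xs; exact: sqr_ge0.
rewrite (iid_second_moment bY Y0); congr EFin; congr (_ + _).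
under [X in mean _ X]eq_fun do rewrite YE.
by rewrite (meanZ _ _ bmeas_sq_centered) mulrA expr2 mulrA mulfV// mul1r.
Qed.

End iid_average.

(* Here [J0], [J1] are the values at consecutive iterates, [X] the squared step
   and [E] the squared gradient error. *)
Lemma descent_arith (R : realFieldType) (eta L J0 J1 Js X E F dg dv de : R) :
  0 < eta -> 4 * L * eta = 1 -> J0 + dg - L * X <= J1 -> X <= eta * dv ->
  2 * (eta * de) <= eta ^+ 2 * E + X -> dv = de + dg ->
  eta ^+ 2 * F <= 2 * X + 2 * (eta ^+ 2 * E) ->
  F + 12 / eta * (Js - J1) + (eta ^+ 2)^-1 * X <= 12 / eta * (Js - J0) + 8 * E.
Proof.
move=> eta0 etaL h1 h2 h3 h4 h5.
(* The hypotheses give eta (J1 - J0) >= X/4 - eta^2 E/2. Twelve times this is 3X - 6 eta^2 E: 2X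
   goes into the bound on [F], X is the surplus, and 8 = 6 + 2 counts the gradient errors. *)
have h6 : eta * (dg - L * X) <= eta * (J1 - J0) by rewrite ler_pM2l//; lra.
have hL : eta * (L * X) = 4^-1 * X by rewrite mulrA; congr (_ * _); lra.
rewrite -subr_ge0 (_ : _ - _ = (eta ^+ 2)^-1 * (12 * (eta * (J1 - J0)) +
    8 * (eta ^+ 2 * E) - eta ^+ 2 * F - X)); last by field; rewrite gt_eqF.
rewrite mulr_ge0 ?invr_ge0 ?sqr_ge0//.
by move: h6; rewrite mulrBr hL; rewrite h4 in h2; lra.
Qed.

Section srvr_pg_analysis.
Context dS dA (S : measurableType dS) (A : measurableType dA) {R : realType}
  (nu : {sigma_finite_measure set A -> \bar R}) (d : nat)
  (D : mdp S A R) (pol : policy_class S nu d) (Theta : set 'rV[R]_d).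
Variables (m N B : nat) (L eta Jstar V K : R).
Local Notation J := (performance D pol).
Local Notation g := (grad (performance D pol)).
Local Notation gmap := (gradient_mapping D pol Theta eta).
Implicit Types th v : 'rV[R]_d.

Hypotheses (Theta0 : Theta !=set0) (closedTheta : closed Theta).
Hypothesis convexTheta : convex_set Theta.
Hypothesis eta_gt0 : 0 < eta.
Hypothesis etaL : 4 * L * eta = 1.
Hypothesis smooth : forall th v,
  J th + dot (g th) v - L * l2norm v ^+ 2 <= J (th + v).
Hypothesis Jmax : forall th, Theta th -> J th <= Jstar.
Hypotheses (m_gt0 : (0 < m)%N) (B_gt0 : (0 < B)%N) (V_ge0 : 0 <= V) (K_ge0 : 0 <= K).
(** The estimators enter the analysis only through [batchN] and [batchB]: the variance of a full
    batch and the growth of the error in one recursive update. Both are stated for affine functions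
    of the squared error, since the bound on the rest of the run has this shape. *)
Hypothesis batchN : forall th c a, 0 <= c -> 0 <= a ->
  (\int[iid (traj_law D pol th) N]_taus (c + a * l2norm
     (N%:R^-1 *: \sum_(i < N) pg_estimator pol th (tnth taus i) - g th) ^+ 2)%:E
   <= (c + a * (V / N%:R))%:E)%E.
Hypothesis batchB : forall thp th v c a, 0 <= c -> 0 <= a ->
  (\int[iid (traj_law D pol th) B]_taus (c + a * l2norm
     (v + B%:R^-1 *: \sum_(j < B) (pg_estimator pol th (tnth taus j) -
        is_pg_estimator pol thp th (tnth taus j)) - g th) ^+ 2)%:E
   <= (c + a * (l2norm (v - g thp) ^+ 2 + K / B%:R * l2norm (th - thp) ^+ 2))%:E)%E.
Hypothesis KB : 8 * m%:R * (K / B%:R) <= (eta ^+ 2)^-1.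

Let f th := l2norm (gmap th) ^+ 2.
Let next th v := proj Theta (th + eta *: v).
Let gap th := 12 / eta * (Jstar - J th).

Lemma next_in th v : Theta (next th v).
Proof. exact: proj_in. Qed.

Lemma gap_ge0 th : Theta th -> 0 <= gap th.
Proof.
by move=> /Jmax h; rewrite mulr_ge0 ?divr_ge0 ?subr_ge0// ltW.
Qed.

(** The gradient mapping uses the exact gradient while the step uses [v]; nonexpansiveness of the
    projection makes the two next points differ by at most eta |v - g th|. The projection inequality
    tested at [th] supplies the ascent along the step. *)
Lemma step_descent th v : Theta th ->
  f th + gap (next th v) + (eta ^+ 2)^-1 * l2norm (next th v - th) ^+ 2 <=
  gap th + 8 * l2norm (v - g th) ^+ 2.
Proof.
move=> Tth; set th1 := next th v.
have [x xE] : exists x, th1 - th = x by exists (th1 - th).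
have [e eE] : exists e, v - g th = e by exists (v - g th).
rewrite xE eE.
have h1 := smooth th (th1 - th); rewrite (addrC th) subrK xE in h1.
have h2 : l2norm x ^+ 2 <= eta * dot v x.
  have := proj_variational Theta0 closedTheta convexTheta (th + eta *: v) Tth.
  rewrite -/(next th v) -/th1.
  have -> : th + eta *: v - th1 = eta *: v - x by rewrite -xE opprB addrA (addrC th).
  have -> : th - th1 = - x by rewrite -xE opprB.
  by rewrite l2norm_sq dotNr oppr_le0 dotDl dotNl dotZl subr_ge0.
have h3 : 2 * (eta * dot e x) <= eta ^+ 2 * l2norm e ^+ 2 + l2norm x ^+ 2.
  exact: dot_young.
have h4 : dot v x = dot e x + dot (g th) x by rewrite -eE !dotE; ring.
have h5 : eta ^+ 2 * f th <= 2 * l2norm x ^+ 2 + 2 * (eta ^+ 2 * l2norm e ^+ 2).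
  have -> : eta ^+ 2 * f th = l2norm (x + (next th (g th) - th1)) ^+ 2.
    rewrite /f /gradient_mapping l2normZ exprMn real_normK ?num_real//.
    rewrite mulrA exprVn mulfV ?mul1r; last by rewrite expf_neq0// gt_eqF.
    by congr (l2norm _ ^+ 2); rewrite -xE [RHS]addrC addrA subrK.
  apply: (le_trans (l2normD_sq _ _)); rewrite lerD2l ler_wpM2l//.
  rewrite -exprMn lerXn2r ?nnegrE ?mulr_ge0 ?l2norm_ge0 ?(ltW eta_gt0)//.
  apply: (le_trans (proj_nonexpansive Theta0 closedTheta convexTheta _ _)).
  rewrite opprD addrACA subrr add0r -scalerBr l2normZ gtr0_norm//.
  by rewrite -opprB l2normN eE.
exact: (descent_arith _ eta_gt0 etaL h1 h2 h3 h4 h5).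
Qed.

(** Of the 8 (k+1) copies of the current error, 8 pay for this step and 8 k pass to the later ones.
    The new term 8 k K/B |next - th|^2 is paid by the surplus of [step_descent], thanks to [KB]. *)
Lemma potential_step th v k c a : 0 <= a -> Theta th -> (k < m)%N ->
  c + a * f th + a * (gap (next th v) + 8 * k%:R *
    (l2norm (v - g th) ^+ 2 + K / B%:R * l2norm (next th v - th) ^+ 2)) <=
  c + a * gap th + a * (8 * k.+1%:R) * l2norm (v - g th) ^+ 2.
Proof.
move=> a0 Tth km; have hd := step_descent v Tth.
have k0 : 8 * k%:R * (K / B%:R) <= (eta ^+ 2)^-1.
  apply: le_trans KB; rewrite ler_wpM2r ?divr_ge0// ler_wpM2l// ler_nat.
  exact: ltnW.
have X0 := sqr_ge0 (l2norm (next th v - th)).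
have {}hd : a * (f th + gap (next th v) + 8 * k%:R * (K / B%:R) *
    l2norm (next th v - th) ^+ 2) <= a * (gap th + 8 * l2norm (v - g th) ^+ 2).
  by rewrite ler_wpM2l//; apply: le_trans hd; rewrite lerD2l ler_wpM2r.
rewrite -natr1; move: hd {X0 k0}; move: (f th) (gap th) (gap _) (K / _).
by move: (l2norm _ ^+ 2) (l2norm _ ^+ 2) => X Y p q t w; lra.
Qed.

Lemma inner_loop_ge0 k thp th v (F : seq 'rV[R]_d -> \bar R) :
  (forall ths, 0 <= F ths)%E ->
  (0 <= inner_loop D pol Theta eta B k thp th v F)%E.
Proof.
elim: k thp th v F => [|k IH] thp th v F F0 /=; first exact: F0.
by apply: integral_ge0 => taus _; apply: IH => ths; exact: F0.
Qed.

(** [F] is the rest of the program. The constant [c] collects the squared gradient mappings already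
    met, so it varies in the induction; [a] is the weight of one iterate in the final average. The
    last iterate [z] counts only through its gap, because it starts the next epoch. *)
Lemma inner_loop_bound k thp th v c a (F : seq 'rV[R]_d -> \bar R) :
  (k <= m)%N -> 0 <= c -> 0 <= a -> Theta th -> (forall ths, 0 <= F ths)%E ->
  (forall ys z, size ys = k -> Theta z ->
     F (rcons ys z) <= (c + a * (\sum_(x <- ys) f x + gap z))%:E)%E ->
  (inner_loop D pol Theta eta B k thp th v F <=
   (c + a * (gap th + 8 * k%:R * (l2norm (v - g thp) ^+ 2 +
      K / B%:R * l2norm (th - thp) ^+ 2)))%:E)%E.
Proof.
elim: k thp th v c F => [|k IH] thp th v c F km c0 a0 Tth F0 FP.
  have := FP [::] th erefl Tth; rewrite big_nil add0r => h.
  by rewrite mulr0 mul0r addr0; exact: h.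
pose v' (taus : B.-tuple (traj S A (horizon D))) := v + B%:R^-1 *:
  \sum_(j < B) (pg_estimator pol th (tnth taus j) -
    is_pg_estimator pol thp th (tnth taus j)).
apply: (@le_trans _ _ (\int[iid (traj_law D pol th) B]_taus
    (c + a * gap th + (a * (8 * k.+1%:R)) * l2norm (v' taus - g th) ^+ 2)%:E)%E).
  apply: ge0_le_integralW => [taus|taus].
    by apply: inner_loop_ge0 => ths; exact: F0.
  have fth0 : 0 <= f th by exact: sqr_ge0.
  apply: (le_trans (IH th (next th (v' taus)) (v' taus) (c + a * f th) _ _ _ _ _ _ _)).
  - exact: ltnW.
  - by rewrite addr_ge0// mulr_ge0.
  - by [].
  - exact: next_in.
  - by move=> ths; exact: F0.
  - move=> ys z sz Tz; have := FP (th :: ys) z; rewrite /= sz => /(_ erefl Tz).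
    by rewrite big_cons /ret; congr (_ <= _%:E)%E; ring.
  rewrite lee_fin.
  exact: potential_step.
apply: (le_trans (batchB _ _ _ _ _)).
- by rewrite addr_ge0// mulr_ge0// gap_ge0.
- by rewrite !mulr_ge0.
by rewrite lee_fin le_eqVlt; apply/orP; left; apply/eqP; ring.
Qed.

(** The initial step and the [m.-1] inner steps are m potential steps in all; the initial gradient
    error, of mean square at most V/N, is therefore charged with 8 m. *)
Lemma epoch_bound th c a (F : seq 'rV[R]_d -> \bar R) :
  0 <= c -> 0 <= a -> Theta th -> (forall ths, 0 <= F ths)%E ->
  (forall ys z, size ys = m -> Theta z ->
     F (rcons ys z) <= (c + a * (\sum_(x <- ys) f x + gap z))%:E)%E ->
  (epoch D pol Theta m eta N B th F <=
   (c + a * (gap th + 8 * m%:R * (V / N%:R)))%:E)%E.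
Proof.
move=> c0 a0 Tth F0 FP; rewrite /epoch /bind /batch /sample.
pose v0 (taus : N.-tuple (traj S A (horizon D))) := N%:R^-1 *:
  \sum_(i < N) pg_estimator pol th (tnth taus i).
apply: (@le_trans _ _ (\int[iid (traj_law D pol th) N]_taus
    (c + a * gap th + (a * (8 * m%:R)) * l2norm (v0 taus - g th) ^+ 2)%:E)%E).
  apply: ge0_le_integralW => [taus|taus].
    by apply: inner_loop_ge0 => ths; exact: F0.
  have fth0 : 0 <= f th by exact: sqr_ge0.
  apply: (le_trans (@inner_loop_bound m.-1 th (next th (v0 taus)) (v0 taus)
      (c + a * f th) a _ _ _ _ _ _ _)).
  - exact: leq_pred.
  - by rewrite addr_ge0// mulr_ge0.
  - by [].
  - exact: next_in.
  - by move=> ths; exact: F0.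
  - move=> ys z sz Tz; have := FP (th :: ys) z; rewrite /= sz prednK//.
    move=> /(_ erefl Tz).
    by rewrite big_cons /ret; congr (_ <= _%:E)%E; ring.
  rewrite lee_fin.
  rewrite -[in leRHS](prednK m_gt0); apply: potential_step => //.
  by rewrite ltn_predL.
apply: (le_trans (batchN _ _ _)).
- by rewrite addr_ge0// mulr_ge0// gap_ge0.
- by rewrite !mulr_ge0.
by rewrite lee_fin le_eqVlt; apply/orP; left; apply/eqP; ring.
Qed.

Lemma epochs_ge0 s th (F : seq 'rV[R]_d -> \bar R) :
  (forall ths, 0 <= F ths)%E -> (0 <= epochs D pol Theta m eta N B s th F)%E.
Proof.
elim: s th F => [|s IH] th F F0 /=; first exact: F0.
apply: integral_ge0 => taus _; apply: inner_loop_ge0 => ths.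
by apply: IH => rest; exact: F0.
Qed.

(** The gap left by one epoch is the initial gap of the next, so gaps telescope and only the batch
    errors 8 m V/N add up. *)
Lemma epochs_bound s th c a (F : seq 'rV[R]_d -> \bar R) :
  0 <= c -> 0 <= a -> Theta th -> (forall ths, 0 <= F ths)%E ->
  (forall ys, size ys = (s * m)%N -> F ys <= (c + a * \sum_(x <- ys) f x)%:E)%E ->
  (epochs D pol Theta m eta N B s th F <=
   (c + a * (gap th + s%:R * (8 * m%:R * (V / N%:R))))%:E)%E.
Proof.
elim: s th c F => [|s IH] th c F c0 a0 Tth F0 FP.
  rewrite /= /ret; apply: (le_trans (FP [::] erefl)).
  by rewrite lee_fin big_nil mulr0 addr0 lerDl mulr_ge0// mul0r addr0 gap_ge0.
have E0 : 0 <= 8 * m%:R * (V / N%:R) by rewrite !mulr_ge0// invr_ge0.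
apply: (le_trans (@epoch_bound th
    (c + a * (s%:R * (8 * m%:R * (V / N%:R)))) a _ _ a0 Tth _ _)).
- by rewrite addr_ge0// !mulr_ge0.
- by move=> ths; apply: epochs_ge0 => rest; exact: F0.
- move=> ys z sz Tz; rewrite last_rcons.
  apply: (le_trans (IH z (c + a * \sum_(x <- ys) f x) _ _ a0 Tz _ _)).
  + by rewrite addr_ge0// mulr_ge0// sumr_ge0// => x _; exact: sqr_ge0.
  + by move=> rest; exact: F0.
  (* An epoch returns m + 1 points; [take m] drops the last one, which reappears as the first point
     of the next epoch. *)
  + move=> rest srest; rewrite /ret -cats1 take_size_cat//.
    apply: le_trans (FP _ _) _; first by rewrite size_cat sz srest mulSn.
    by rewrite lee_fin big_cat/= mulrDr addrA.
  by rewrite lee_fin le_eqVlt; apply/orP; left; apply/eqP; ring.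
by rewrite lee_fin -natr1 le_eqVlt; apply/orP; left; apply/eqP; ring.
Qed.

Lemma srvr_pg_bound s th : (0 < s)%N -> Theta th ->
  (expect (srvr_pg D pol Theta m eta N B s th) f <=
   ((12 / eta * (Jstar - J th)) / (s * m)%:R + 8 * V / N%:R)%:E)%E.
Proof.
move=> s0 Tth; rewrite /expect /srvr_pg /bind.
have sm0 : (s * m)%:R != 0 :> R by rewrite pnatr_eq0 -lt0n muln_gt0 s0.
(* The weight 1/(s m) is that of the uniform choice; the s batch errors 8 m V/N then average to 8
   V/N. *)
apply: (le_trans (@epochs_bound s th 0 ((s * m)%:R^-1) _ _ _ Tth _ _)).
- by [].
- by rewrite invr_ge0.
- move=> ths; rewrite /uniform_choice mule_ge0 ?lee_fin ?invr_ge0//.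
  by apply: sume_ge0 => x _; rewrite lee_fin sqr_ge0.
- by move=> ys sys; rewrite /uniform_choice sys add0r sumEFin -EFinM.
rewrite lee_fin add0r le_eqVlt; apply/orP; left; apply/eqP.
rewrite /gap -[8 * V / _]mulrA; move: (V / N%:R) (12 / eta * _) => w z.
by move: sm0; rewrite natrM mulf_eq0 negb_or => /andP[? ?]; field; apply/andP.
Qed.

End srvr_pg_analysis.

(** * Choice of the parameters and conclusion *)

Lemma natS_truncn_bounds (R : realType) (x y : R) : 0 <= x -> 1 <= y ->
  x <= (Num.truncn x).+1%:R <= x + y.
Proof.
move=> x0 y1; rewrite (ltW (truncnS_gt x)) -natr1 lerD//.
by rewrite truncn_le.
Qed.

(* With [q] the square root of [eps]: [m] and [S] are of order [1/q], so [S * m]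
   is of order [1/eps], and [N] is of order [1/eps]. *)
Lemma parameter_choice (R : realType) (a b k : R) :
  0 <= a -> 0 <= b -> 0 <= k ->
  exists2 C : R, 0 < C & forall eps : R, 0 < eps <= 1 ->
  exists N B m S : nat,
    [/\ [/\ (0 < N)%N, (0 < B)%N, (0 < m)%N & (0 < S)%N],
        [/\ N%:R <= C / eps, B%:R <= C / eps `^ (1 / 2),
            m%:R <= C / eps `^ (1 / 2) & S%:R <= C / eps `^ (1 / 2)],
        k * m%:R <= B%:R,
        a / (S * m)%:R + b / N%:R <= eps &
        (num_trajectories m N B S)%:R <= C / eps `^ (3 / 2)].
Proof.
move=> a0 b0 k0.
(* [S], [N] and [B] will be at most [cS / q], [cN / q ^+ 2] and [cB / q]. In [cS] and [cN] the 2
   makes each error term at most eps/2, in [cB] it reflects m <= 2/q, and each 1 absorbs rounding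
   up. The product in [C] bounds the total count. *)
pose cS := 2 * a + 1; pose cN := 2 * b + 1; pose cB := 2 * k + 1.
pose C := cS * (cN + 2 * cB) + cN + cB + cS + 2.
have cS1 : 1 <= cS by rewrite /cS; lra.
have cN1 : 1 <= cN by rewrite /cN; lra.
have cB1 : 1 <= cB by rewrite /cB; lra.
have cSNB : 0 <= cS * (cN + 2 * cB) by rewrite mulr_ge0//; lra.
exists C => [|eps /andP[eps0 eps1]]; first by rewrite /C; lra.
set q := eps `^ (1 / 2); have q0 : 0 < q by exact: powR_gt0.
have -> : eps `^ (3 / 2) = q ^+ 3.
  by rewrite -powR_mulrn ?(ltW q0)// -powRrM; congr (_ `^ _); lra.
have qE : eps = q ^+ 2.
  by rewrite -powR_mulrn ?(ltW q0)// -powRrM -[LHS]powRr1 ?ltW//; congr (_ `^ _); lra.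
have q1 : q <= 1 by rewrite -(@expr_le1 _ 2) ?(ltW q0)// -qE.
have qV1 : 1 <= q^-1 by rewrite invf_ge1.
have eV1 : 1 <= (q ^+ 2)^-1 by rewrite invf_ge1 ?exprn_gt0// -qE.
pose m := (Num.truncn q^-1).+1; pose N := (Num.truncn (2 * b / q ^+ 2)).+1.
pose S := (Num.truncn (2 * a / q)).+1; pose B := (Num.truncn (k * m%:R)).+1.
have /andP[m1 m2] : q^-1 <= m%:R <= q^-1 + q^-1.
  by apply: natS_truncn_bounds => //; rewrite invr_ge0 ltW.
have /andP[N1 N2] : 2 * b / q ^+ 2 <= N%:R <= 2 * b / q ^+ 2 + (q ^+ 2)^-1.
  by apply: natS_truncn_bounds => //; apply: divr_ge0; [exact: mulr_ge0|exact: sqr_ge0].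
have /andP[S1 S2] : 2 * a / q <= S%:R <= 2 * a / q + q^-1.
  by apply: natS_truncn_bounds => //; rewrite divr_ge0 ?mulr_ge0// ltW.
have /andP[B1 B2] : k * m%:R <= B%:R <= k * m%:R + q^-1.
  by apply: natS_truncn_bounds => //; rewrite mulr_ge0.
have {}m2 : m%:R <= 2 / q by lra.
have {}N2 : N%:R <= cN / q ^+ 2 by rewrite /cN mulrDl mul1r.
have {}S2 : S%:R <= cS / q by rewrite /cS mulrDl mul1r.
have {}B2 : B%:R <= cB / q.
  apply: (le_trans B2); rewrite /cB mulrDl mul1r lerD2r.
  by apply: (le_trans (ler_wpM2l k0 m2)); rewrite mulrCA mulrA.
have [m0 N0 S0 B0] : [/\ (0 < m)%N, (0 < N)%N, (0 < S)%N & (0 < B)%N] by [].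
clearbody m N S B.
have leC x y : 0 < y -> x <= C -> x / y <= C / y.
  by move=> y0 xC; rewrite ler_wpM2r// invr_ge0 ltW.
exists N, B, m, S; split => //.
- split; rewrite ?qE.
  + by apply: (le_trans N2); apply: leC; rewrite ?exprn_gt0// /C; lra.
  + by apply: (le_trans B2); apply: leC => //; rewrite /C; lra.
  + by apply: (le_trans m2); apply: leC => //; rewrite /C; lra.
  + by apply: (le_trans S2); apply: leC => //; rewrite /C; lra.
- have Sm : 2 * a / q / q <= (S * m)%:R.
    by rewrite natrM ler_pM// ?invr_ge0 ?(ltW q0)// divr_ge0 ?mulr_ge0// ltW.
  have aE : a / (S * m)%:R <= q ^+ 2 / 2.
    rewrite ler_pdivrMr ?ltr0n ?muln_gt0 ?S0//.
    apply: (le_trans _ (ler_wpM2l _ Sm)); last by rewrite divr_ge0// sqr_ge0.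
    by rewrite le_eqVlt; apply/orP; left; apply/eqP; field; rewrite gt_eqF.
  have bE : b / N%:R <= q ^+ 2 / 2.
    rewrite ler_pdivrMr ?ltr0n//.
    apply: (le_trans _ (ler_wpM2l _ N1)); last by rewrite divr_ge0// sqr_ge0.
    by rewrite le_eqVlt; apply/orP; left; apply/eqP; field; rewrite gt_eqF.
  by rewrite qE; lra.
- rewrite /num_trajectories natrM natrD natrM.
  have mB : m.-1%:R * B%:R <= 2 * cB / q ^+ 2 :> R.
    have -> : 2 * cB / q ^+ 2 = (2 / q) * (cB / q) by field; rewrite gt_eqF.
    by rewrite ler_pM//; apply: le_trans m2; rewrite ler_nat leq_pred.
  apply: (@le_trans _ _ (cS / q * (cN / q ^+ 2 + 2 * cB / q ^+ 2))).
    by rewrite ler_pM// ?addr_ge0// ?mulr_ge0// lerD.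
  have -> : cS / q * (cN / q ^+ 2 + 2 * cB / q ^+ 2) =
      cS * (cN + 2 * cB) / q ^+ 3 by field; rewrite gt_eqF.
  by apply: leC; rewrite ?exprn_gt0// /C; lra.
Qed.

Theorem corollary4p7 (R : realType) (dS dA : measure_display)
  (St : measurableType dS) (Ac : measurableType dA)
  (nu : {sigma_finite_measure set Ac -> \bar R}) (d : nat)
  (D : mdp St Ac R) (pol : policy_class St nu d)
  (Rmax G M xi W : R) (Theta : set 'rV[R]_d) (theta0 : 'rV[R]_d) :
  let gamma := discount D in
  let L := M * Rmax / (1 - gamma) ^+ 2
           + 2 * G ^+ 2 * Rmax / (1 - gamma) ^+ 3 in
  let eta := 1 / (4 * L) in
  0 < Rmax -> (forall sa, - Rmax <= reward D sa <= Rmax) ->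
  0 < gamma < 1 -> (1 <= horizon D)%N ->
  Theta !=set0 -> closed Theta -> convex_set Theta ->
  (exists2 u, Theta u & forall w, Theta w ->
     performance D pol w <= performance D pol u) ->
  (* (A1) *)
  0 < G -> 0 < M ->
  (forall sa, twice_differentiable (log_pi pol sa)) ->
  (forall th sa, l2norm (grad (log_pi pol sa) th) <= G) ->
  (forall th sa, spectral_norm (hessian (log_pi pol sa) th) <= M) ->
  (* (A2) *)
  0 < xi ->
  (forall th, (vvar (traj_law D pol th) (pg_estimator pol th)
               <= (xi ^+ 2)%:E)%E) ->
  (* (A3) *)
  (forall th1 th2,
    ('V_(traj_law D pol th2)[fun tau =>
        (likelihood pol th1 tau / likelihood pol th2 tau)%R] <= W%:E)%E) ->
  Theta theta0 ->
  exists2 C : R, 0 < C &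
    forall eps : R, 0 < eps <= 1 ->
    exists N B m S : nat,
      [/\ [/\ (0 < N)%N, (0 < B)%N, (0 < m)%N & (0 < S)%N],
          [/\ N%:R <= C / eps,
              B%:R <= C / eps `^ (1 / 2),
              m%:R <= C / eps `^ (1 / 2) &
              S%:R <= C / eps `^ (1 / 2)],
          B%:R >= 72 * m%:R * eta * G ^+ 2 * (2 * G ^+ 2 / M + 1) * (W + 1)
                  * gamma / (1 - gamma) ^+ 2,
          (expect (srvr_pg D pol Theta m eta N B S theta0)
             (fun th => (l2norm (gradient_mapping D pol Theta eta th) ^+ 2)%R)
           <= eps%:E)%E &
          (num_trajectories m N B S)%:R <= C / eps `^ (3 / 2)].
Proof.
have arith (x y z w : R) : - w <= x - y - z -> y + z - w <= x by lra.
move=> gamma L0 eta Rmax0 rewardP gammaP _ Theta0 clTheta cvTheta.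
move=> [ustar Tu umax] G0 M0 pol2 polG polM xi0 varP polW Ttheta0.
have Lp : 0 < L0 := Lsmooth_gt0 gammaP G0 M0 Rmax0.
have eta0 : 0 < eta by rewrite /eta divr_gt0// mulr_gt0.
have etaL : 4 * L0 * eta = 1 by rewrite /eta; field; rewrite gt_eqF.
have gradE := grad_performance rewardP gammaP G0 M0 Rmax0 pol2 polG polM.
have smooth th v : performance D pol th +
    dot (grad (performance D pol) th) v - L0 * l2norm v ^+ 2 <=
    performance D pol (th + v).
  have := smooth_mean_pg rewardP gammaP G0 M0 Rmax0 pol2 polG polM th v.
  by rewrite gradE ler_norml => /andP[h _]; exact: arith.
have bpg th := bmeas_pg_estimator rewardP pol2 polG th.
pose K := Cdiff D Rmax G M W.
pose X := 72 * eta * G ^+ 2 * (2 * G ^+ 2 / M + 1) * (W + 1)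
  * gamma / (1 - gamma) ^+ 2.
(* [kappa * m] dominates both the prescribed bound [X * m] on the batch size and the amount 8 K
   eta^2 m that the potential argument asks for. *)
pose kappa := `|X| + 8 * `|K| * eta ^+ 2.
pose J := performance D pol.
have [|||C C0 HC] := @parameter_choice R (12 / eta * (J ustar - J theta0))
    (8 * xi ^+ 2) kappa.
- apply: mulr_ge0; first by rewrite divr_ge0// ltW.
  by rewrite subr_ge0; exact: umax.
- by apply: mulr_ge0 => //; exact: sqr_ge0.
- by apply: addr_ge0 => //; apply: mulr_ge0; [exact: mulr_ge0|exact: sqr_ge0].
exists C => // eps eps01.
have [N [B [m [S [[N0 B0 m0 S0] bounds kB acc tot]]]]] := HC eps eps01.
exists N, B, m, S; split => //.
- apply: le_trans kB.
  rewrite [leLHS](_ : _ = X * m%:R); last by rewrite /X; ring.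
  rewrite ler_wpM2r// (le_trans (ler_norm X))// lerDl.
  by apply: mulr_ge0; [exact: mulr_ge0|exact: sqr_ge0].
apply: (le_trans (@srvr_pg_bound _ _ St Ac R nu d D pol Theta m N B L0 eta
  (J ustar) (xi ^+ 2) `|K| Theta0 clTheta cvTheta eta0 etaL
  smooth umax m0 _ _ _ _ _ S theta0 S0 Ttheta0)).
- exact: sqr_ge0.
- exact: normr_ge0.
- move=> th c a c0 a0; rewrite gradE.
  have := iid_average_second_moment (traj_law D pol th) (bpg th) 0 N0 c0 a0.
  under eq_integral do rewrite add0r.
  move=> ->; rewrite lee_fin lerD2l ler_wpM2l//.
  rewrite l2norm0 expr0n add0r mulrC ler_wpM2r ?invr_ge0//.
  rewrite -lee_fin -expectation_mean; first exact: varP.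
  by apply: bmeas_sq_centered; exact: bpg.
- move=> thp th v c a c0 a0.
  pose Z (tau : traj St Ac (horizon D)) :=
    pg_estimator pol th tau - is_pg_estimator pol thp th tau.
  have bZ i : bmeas (fun tau => Z tau ord0 i).
    exact: (bmeas_estimatorB rewardP pol2 polG th thp i).
  have ZE : vmean (traj_law D pol th) Z = mean_pg D pol th - mean_pg D pol thp.
    exact: (vmean_estimatorB rewardP pol2 polG).
  (* With the offset [v - mean_pg D pol thp], adding the centered batch average gives exactly the
     new error: the means at [thp] cancel. *)
  have := iid_average_second_moment (traj_law D pol th) bZ
    (v - mean_pg D pol thp) B0 c0 a0.
  under eq_integral => taus _.
    rewrite ZE opprB addrACA addKr.
    over.
  rewrite !gradE => ->; rewrite lee_fin lerD2l ler_wpM2l// lerD2l.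
  rewrite mulrC mulrAC ler_wpM2r ?invr_ge0//.
  apply: (le_trans (mean_sq_centered_le _ bZ)).
  have := mean_sq_estimatorB rewardP gammaP G0 M0 Rmax0 pol2 polG polM polW
    th (thp - th).
  rewrite (addrC th) subrK -(l2normN (thp - th)) opprB => h.
  by apply: (le_trans h); rewrite ler_wpM2r ?sqr_ge0// ler_norm.
- have h : 8 * `|K| * eta ^+ 2 * m%:R <= B%:R.
    by apply: le_trans kB; rewrite ler_wpM2r// lerDr.
  rewrite mulrA ler_pdivrMr ?ltr0n// ler_pdivlMl ?exprn_gt0//.
  by apply: le_trans h; rewrite le_eqVlt; apply/orP; left; apply/eqP; ring.
- by rewrite lee_fin.
Qed.
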